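(* The group $U_0(Q)$ of Fredholm index zero unitaries in the Calkin algebra $Q=B(H)/\mathcal K(H)$, regarded as a metric group with the norm metric $d(u,v)=\|u-v\|$, is not countably homogeneous. That is, it is not the case that for any two sequences $\bar a=(a_n:n\in\mathbb N)$ and $\bar b=(b_n:n\in\mathbb N)$ in $U_0(Q)$ having the same type in $U_0(Q)$ and every $c\in U_0(Q)$ there exists $d\in U_0(Q)$ such that $(\bar a,c)$ and $(\bar b,d)$ have the same type in $U_0(Q)$.
   Context: $H$ is a separable infinite-dimensional complex Hilbert space and $\mathcal K(H)$ is the ideal of compact operators. $U_0(Q)$ is the group of unitaries of $Q$ whose Fredholm index is zero (equivalently, the connected component of the identity in the unitary group of $Q$). Formulas in the language of metric groups: atomic formulas are expressions $d(s(\bar x),t(\bar x))$, where $s,t$ are group words (built from variables, the identity, multiplication and inverse). The set of formulas is the smallest set containing all atomic formulas such that (i) if $f\colon[0,\infty)^n\to[0,\infty)$ is continuous and $\phi_1,\dots,\phi_n$ are formulas, then $f(\phi_1,\dots,\phi_n)$ is a formula; (ii) if $\phi$ is a formula and $x$ is a variable, then $\sup_x\phi$ and $\inf_x\phi$ are formulas. For a (bounded) metric group $G$ and $a_1,\dots,a_n\in G$, the interpretation $\phi(a_1,\dots,a_n)^G\in[0,\infty)$ is defined by the obvious recursion, with quantifiers ranging over $G$. A condition is an expression $\phi\le r$ with $\phi$ a formula and $r\ge 0$. The type of a sequence $\bar a$ in $G$ is the set of all conditions $\phi(x_1,\dots,x_m)\le r$ such that $\phi(a_1,\dots,a_m)^G\le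 r$. *)

(* Defs.v *)
From HB Require Import structures.
From mathcomp Require Import all_boot all_order all_algebra.
From mathcomp Require Import all_classical all_reals all_analysis.
From mathcomp Require Import complex sesquilinear ring_quotient.

Set Implicit Arguments.
Unset Strict Implicit.
Unset Printing Implicit Defensive.

Import Order.TTheory GRing.Theory Num.Theory.
Import numFieldNormedType.Exports.

Local Open Scope classical_set_scope.
Local Open Scope ring_scope.
Local Open Scope complex_scope.

Record hilbertSpace (R : realType) := HilbertSpace {
  hilbert_sort :> completeNormedModType R[i];
  hdot : {dot hilbert_sort for (@Num.conj R[i])};
  hdot_norm : forall x, hdot x x = `|x| ^+ 2 }.

Definition separable_space (T : topologicalType) : Prop :=
  exists2 D : set T, countable D & dense D.

Section Dimension.
Context (K : fieldType) (V : lmodType K).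
Implicit Types (W : set V) (n : nat).

Definition has_dim W n : Prop :=
  exists e : 'I_n -> V, (forall i, W (e i)) /\
    forall x, W x -> exists! c : 'rV[K]_n, x = \sum_i c 0 i *: e i.

(* [f] induces a basis of the quotient space [V / W] *)
Definition has_codim W n : Prop :=
  exists f : 'I_n -> V,
    forall x, exists! c : 'rV[K]_n, W (x - \sum_i c 0 i *: f i).

Definition infinite_dimensional : Prop := forall n, ~ has_dim [set: V] n.

End Dimension.

Section BoundedOperators.
Context (R : realType) (H : hilbertSpace R).

Definition bounded_linear (T : H -> H) : Prop :=
  linear T /\ exists M : R[i], forall x, `|T x| <= M * `|x|.

Definition bounded_linear_pred : {pred H -> H} := [pred T | `[< bounded_linear T >]].

Lemma bounded_linearP T : reflect (bounded_linear T) (T \in bounded_linear_pred).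
Proof. by rewrite inE; apply: asboolP. Qed.

Lemma bounded_linear_zmod : zmod_closed bounded_linear_pred.
Proof.
split=> [|S T /bounded_linearP [lS [M SM]] /bounded_linearP [lT [N TN]]];
  apply/bounded_linearP; split.
- by move=> a x y; rewrite (_ : forall z, (0 : H -> H) z = 0)// scaler0 addr0.
- by exists 0 => x; rewrite (_ : (0 : H -> H) x = 0)// normr0 mul0r.
- move=> a x y; rewrite (_ : forall z, (S - T) z = S z - T z)// lS lT.
  by rewrite scalerBr opprD addrACA.
- exists (M + N) => x; rewrite (_ : (S - T) x = S x - T x)// mulrDl.
  by apply: (le_trans (ler_normB _ _)); apply: lerD.
Qed.

HB.instance Definition _ :=
  GRing.isZmodClosed.Build (H -> H) bounded_linear_pred bounded_linear_zmod.

Record bop := Bop { bop_fun :> H -> H; _ : bop_fun \in bounded_linear_pred }.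

HB.instance Definition _ := [isSub for bop_fun].
HB.instance Definition _ := [Choice of bop by <:].
HB.instance Definition _ := [SubChoice_isSubZmodule of bop by <:].

Lemma bopP (T : bop) : bounded_linear T.
Proof. by case: T => T /= /bounded_linearP. Qed.

Lemma bop_eqP (S T : bop) : S =1 T -> S = T.
Proof. by move=> eqST; apply/val_inj/funext. Qed.

Lemma bop_lin (T : bop) : linear T. Proof. by case: (bopP T). Qed.

HB.instance Definition _ (T : bop) :=
  GRing.isLinear.Build R[i] H H *:%R (bop_fun T) (@bop_lin T).

Lemma bopBE (S T : bop) x : (S - T) x = S x - T x. Proof. by []. Qed.
Lemma bopDE (S T : bop) x : (S + T) x = S x + T x. Proof. by []. Qed.

Lemma bounded_linear_id : (idfun : H -> H) \in bounded_linear_pred.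
Proof.
by apply/bounded_linearP; split=> [//|]; exists 1 => x; rewrite mul1r.
Qed.

Lemma bop_ge0 (T : bop) : exists2 M : R[i], 0 < M & forall x, `|T x| <= M * `|x|.
Proof.
have [_ [M TM]] := bopP T.
have [M0|M0] := pselect (exists x : H, x != 0).
  case: M0 => x x0; exists (M + 1).
    have : 0 <= M * `|x| by apply: le_trans (TM x).
    by rewrite pmulr_lge0 ?normr_gt0// => M0; rewrite ltr_wpDl.
  move=> y; apply: (le_trans (TM y)); apply: ler_wpM2r => //.
  by rewrite lerDl.
exists 1 => // x; have -> : x = 0.
  by apply/eqP/negP => /negP x0; apply: M0; exists x.
by rewrite linear0 normr0 mulr0.
Qed.

Lemma bounded_linear_comp (S T : bop) : S \o T \in bounded_linear_pred.
Proof.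
have [M M0 SM] := bop_ge0 S; have [N N0 TN] := bop_ge0 T.
apply/bounded_linearP; split=> [a x y|]; first by rewrite /= !linearP.
exists (M * N) => x /=; apply: (le_trans (SM _)).
by rewrite -mulrA ler_pM2l.
Qed.

Definition bop_one : bop := Bop bounded_linear_id.
Definition bop_mul (S T : bop) : bop := Bop (bounded_linear_comp S T).

Lemma bop_mulA : associative bop_mul. Proof. by move=> S T U; exact: bop_eqP. Qed.
Lemma bop_mul1l : left_id bop_one bop_mul. Proof. by move=> S; exact: bop_eqP. Qed.
Lemma bop_mul1r : right_id bop_one bop_mul. Proof. by move=> S; exact: bop_eqP. Qed.
Lemma bop_mulDl : left_distributive bop_mul +%R.
Proof. by move=> S T U; exact: bop_eqP. Qed.
Lemma bop_mulDr : right_distributive bop_mul +%R.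
Proof. by move=> S T U; apply: bop_eqP => x; exact: (linearD (bop_fun S)). Qed.

HB.instance Definition _ := GRing.Zmodule_isPzRing.Build bop
  bop_mulA bop_mul1l bop_mul1r bop_mulDl bop_mulDr.

Lemma bopME (S T : bop) x : (S * T) x = S (T x). Proof. by []. Qed.
Lemma bop1E x : (1 : bop) x = x. Proof. by []. Qed.

Lemma bop_continuous (T : bop) : continuous T.
Proof.
apply: bounded_linear_continuous; apply/linear_boundedP.
have [M M0 TM] := bop_ge0 T.
exists M; split; first by rewrite ger0_real// ltW.
move=> r Mr x; apply: (le_trans (TM x)).
by apply: ler_wpM2r => //; apply: ltW.
Qed.

Definition opnorm (T : bop) : R :=
  sup [set complex.Re `|T x| | x in [set x : H | `|x| <= 1]].

Definition is_adjoint (T S : bop) : Prop :=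
  forall x y, hdot H (T x) y = hdot H x (S y).

(* A range of finite codimension is automatically closed. *)
Definition fredholm_index (T : bop) (k : int) : Prop :=
  exists m n : nat, [/\ has_dim [set x | T x = 0] m, has_codim (range T) n
    & k = m%:Z - n%:Z].

Definition compact_operator (T : bop) : Prop :=
  precompact (T @` [set x : H | `|x| <= 1]).


Definition compact_pred : {pred bop} := [pred T | `[< compact_operator T >]].

Lemma compact_operatorP T : reflect (compact_operator T) (T \in compact_pred).
Proof. by rewrite inE; apply: asboolP. Qed.

Lemma compact_operatorE T : compact_operator T <->
  exists2 C : set H, compact C & forall x, `|x| <= 1 -> C (T x).
Proof.
split=> [|[C cC TC]].
  rewrite /compact_operator precompactE => cT.
  exists (closure (T @` [set x : H | `|x| <= 1])) => //.
  by move=> x x1; apply: subset_closure; exists x.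
apply: (@precompact_subset _ _ C); first by move=> _ [x x1 <-]; exact: TC.
exact/compact_precompact/cC/norm_hausdorff.
Qed.

Lemma compact_operatorB S T :
  compact_operator S -> compact_operator T -> compact_operator (S - T).
Proof.
move=> /compact_operatorE [C cC SC] /compact_operatorE [D cD TD].
apply/compact_operatorE.
exists ((fun p : H * H => p.1 - p.2) @` (C `*` D)).
  apply: continuous_compact; last exact: compact_setX.
  apply: continuous_subspaceT => p.
  by apply: cvgB; [exact: cvg_fst|exact: cvg_snd].
by move=> x x1; exists (S x, T x) => //; split; [exact: SC|exact: TD].
Qed.

Lemma compact_pred_zmod : zmod_closed compact_pred.
Proof.
split=> [|S T /compact_operatorP cS /compact_operatorP cT]; apply/compact_operatorP.
  apply/compact_operatorE; exists [set 0]; first exact: compact_set1.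
  by [].
exact: compact_operatorB.
Qed.

HB.instance Definition _ := GRing.isZmodClosed.Build bop compact_pred compact_pred_zmod.

Lemma compact_operatorMl (T K : bop) : compact_operator K -> compact_operator (T * K).
Proof.
move=> /compact_operatorE [C cC KC]; apply/compact_operatorE.
exists (T @` C); last by move=> x x1; exists (K x) => //; exact: KC.
by apply: continuous_compact => //; apply/continuous_subspaceT/bop_continuous.
Qed.

Lemma compact_operatorMr (K T : bop) : compact_operator K -> compact_operator (K * T).
Proof.
move=> /compact_operatorE [C cC KC]; apply/compact_operatorE.
have [M M0 TM] := bop_ge0 T.
exists ((fun y : H => M *: y) @` C).
  apply: continuous_compact => //; apply: continuous_subspaceT => y.
  exact: scaler_continuous.
move=> x x1; exists (K (M^-1 *: T x)).
  apply: KC; rewrite normrZ normfV (gtr0_norm M0) mulrC ler_pdivrMr// mul1r.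
  by apply: (le_trans (TM x)); rewrite ler_piMr// ltW.
by rewrite linearZ /= scalerA divff ?scale1r// gt_eqF.
Qed.

Definition calkin : Type := Quotient.quot (compact_pred : zmodClosed bop).

HB.instance Definition _ := GRing.Zmodule.on calkin.
HB.instance Definition _ := EqQuotient.on calkin.

Definition to_calkin (T : bop) : calkin := \pi_calkin%qT T.

Lemma to_calkin_eqP (S T : bop) :
  to_calkin S = to_calkin T <-> compact_operator (S - T).
Proof.
split=> [/eqP|cST]; last apply/eqP.
  by rewrite -Quotient.idealrBE => /compact_operatorP.
by rewrite -Quotient.idealrBE; apply/compact_operatorP.
Qed.

Lemma to_calkin_repr u : to_calkin (repr u) = u. Proof. exact: reprK. Qed.

Definition calkin_one : calkin := to_calkin 1.
Definition calkin_mul (u v : calkin) : calkin := to_calkin (repr u * repr v).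

Lemma to_calkinD : {morph to_calkin : S T / S + T >-> S + T}.
Proof. by move=> S T; rewrite /to_calkin piE. Qed.

Lemma to_calkinM S T : to_calkin (S * T) = calkin_mul (to_calkin S) (to_calkin T).
Proof.
have cS : compact_operator (S - repr (to_calkin S)).
  by apply/to_calkin_eqP; rewrite to_calkin_repr.
have cT : compact_operator (T - repr (to_calkin T)).
  by apply/to_calkin_eqP; rewrite to_calkin_repr.
apply/to_calkin_eqP; rewrite -[_ - _](subrKA (S * repr (to_calkin T))).
rewrite -mulrBr -[_ - repr (to_calkin S) * _]mulrBl.
rewrite -[X in _ + X]opprK; apply: compact_operatorB.
  exact: compact_operatorMl.
rewrite -mulNr opprB; apply: compact_operatorMr.
by apply/compact_operatorP; rewrite -opprB rpredN; apply/compact_operatorP.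
Qed.

Lemma calkin_mulA : associative calkin_mul.
Proof.
move=> u v w; rewrite -[u]to_calkin_repr -[v]to_calkin_repr -[w]to_calkin_repr.
by rewrite -!to_calkinM mulrA.
Qed.

Lemma calkin_mul1l : left_id calkin_one calkin_mul.
Proof. by move=> u; rewrite -[u]to_calkin_repr -to_calkinM mul1r. Qed.

Lemma calkin_mul1r : right_id calkin_one calkin_mul.
Proof. by move=> u; rewrite -[u]to_calkin_repr -to_calkinM mulr1. Qed.

Lemma calkin_mulDl : left_distributive calkin_mul +%R.
Proof.
move=> u v w; rewrite -[u]to_calkin_repr -[v]to_calkin_repr -[w]to_calkin_repr.
by rewrite -to_calkinD -!to_calkinM mulrDl to_calkinD.
Qed.

Lemma calkin_mulDr : right_distributive calkin_mul +%R.
Proof.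
move=> u v w; rewrite -[u]to_calkin_repr -[v]to_calkin_repr -[w]to_calkin_repr.
by rewrite -to_calkinD -!to_calkinM mulrDr to_calkinD.
Qed.

HB.instance Definition _ := GRing.Zmodule_isPzRing.Build calkin
  calkin_mulA calkin_mul1l calkin_mul1r calkin_mulDl calkin_mulDr.

Lemma to_calkin_is_zmod_morphism : zmod_morphism to_calkin.
Proof. by move=> S T; rewrite /to_calkin !piE. Qed.

Lemma to_calkin_is_monoid_morphism : monoid_morphism to_calkin.
Proof. by split=> // S T; rewrite to_calkinM. Qed.

HB.instance Definition _ :=
  GRing.isZmodMorphism.Build bop calkin to_calkin to_calkin_is_zmod_morphism.
HB.instance Definition _ :=
  GRing.isMonoidMorphism.Build bop calkin to_calkin to_calkin_is_monoid_morphism.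

(* The quotient norm. *)
Definition calkin_norm (u : calkin) : R :=
  inf [set opnorm T | T in [set T | to_calkin T = u]].

(* [v = u^*], i.e. [v] is the class of the adjoint of a lift of [u]; the choice of the lift
   is immaterial since adjoints of compact operators are compact. *)
Definition calkin_adjoint (u v : calkin) : Prop :=
  exists T S : bop, [/\ to_calkin T = u, to_calkin S = v & is_adjoint T S].

Definition calkin_unitary (u : calkin) : Prop :=
  exists v, [/\ calkin_adjoint u v, v * u = 1 & u * v = 1].

(* The index does not depend on the lift, being invariant under compact perturbations. *)
Definition calkin_index (u : calkin) (k : int) : Prop :=
  exists2 T : bop, to_calkin T = u & fredholm_index T k.

Definition in_U0 (u : calkin) : Prop := calkin_unitary u /\ calkin_index u 0.

Lemma invertible_index (A B : bop) : A * B = 1 -> B * A = 1 -> fredholm_index A 0.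
Proof.
move=> AB BA; have ABx x : A (B x) = x by rewrite -bopME AB.
have BAx x : B (A x) = x by rewrite -bopME BA.
have c0 (c : 'rV[R[i]]_0) : 0 = c by rewrite thinmx0.
exists 0%N, 0%N; split=> //.
  exists (fun i => match i : 'I_0 with Ordinal _ i0 => False_rect _ (notF i0) end).
  split=> [[]//|x /= Ax0]; exists 0; split=> [|c _]; last exact: c0.
  by rewrite big_ord0 -(BAx x) Ax0 linear0.
exists (fun i => match i : 'I_0 with Ordinal _ i0 => False_rect _ (notF i0) end).
move=> x; exists 0; split=> [|c _]; last exact: c0.
by rewrite big_ord0 subr0; exists (B x) => //; rewrite ABx.
Qed.

Lemma hdot_bound (e : H) : exists2 M : R[i], 0 <= M & forall x, `|hdot H x e| <= M * `|x|.
Proof.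
have [->|e0] := eqVneq e 0.
  by exists 0 => // x; rewrite linear0r normr0 mul0r.
exists `|e| => // x.
have ee0 : 0 < hdot H e e by rewrite dnorm_gt0.
pose a := hdot H x e / hdot H e e.
have orth : hdot H (x - a *: e) e = 0.
  by rewrite linearBl /= linearZl_LR /= divfK ?subrr// gt_eqF.
have : 0 <= hdot H (x - a *: e) x.
  have := dnorm_ge0 (hdot H) (x - a *: e).
  by rewrite linearBr /= linearZr_LR /= orth mulr0 subr0.
rewrite linearBl /= linearZl_LR /= (hermC (hdot H) e x) expr0 mul1r subr_ge0.
rewrite /a mulrAC -normCK ler_pdivrMr// !hdot_norm -exprMn mulrC.
by rewrite ler_pXn2r ?nnegrE// ?mulr_ge0.
Qed.

Lemma rank1_bounded (e f : H) : (fun x : H => hdot H x e *: f) \in bounded_linear_pred.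
Proof.
have [M M0 eM] := hdot_bound e.
apply/bounded_linearP; split=> [a x y|]; first by rewrite linearPl /= scalerDl scalerA.
exists (M * `|f|) => x; rewrite normrZ mulrAC.
by apply: ler_wpM2r.
Qed.

Definition rank1 (e f : H) : bop := Bop (rank1_bounded e f).

Lemma real_complex_continuous : continuous (fun a : R => a%:C : R[i]^o).
Proof.
move=> a; apply/cvgrPdist_lt => /= eps eps0.
have epsR : eps = (complex.Re eps)%:C by rewrite RRe_real// gtr0_real.
rewrite epsR ltcR in eps0; near=> b.
rewrite epsR -rmorphB /= normc_def /= expr0n /= addr0 sqrtr_sqr ltcR.
near: b; have : b @[b --> a] --> (a : R^o) by exact: cvg_id.
by move=> /cvgrPdist_lt; apply.
Unshelve. all: by end_near. Qed.

Lemma rank1_compact e f : compact_operator (rank1 e f).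
Proof.
have [M M0 eM] := hdot_bound e.
have MR : M = (complex.Re M)%:C by rewrite RRe_real// ger0_real.
apply/compact_operatorE.
pose m := complex.Re M.
exists ((fun p : R * R => p.1%:C *: f + p.2%:C *: ('i *: f)) @` (`[- m, m] `*` `[- m, m])).
  apply: continuous_compact; last by apply: compact_setX; exact: segment_compact.
  apply: continuous_subspaceT => p; apply: cvgD.
    apply: (@cvgZr_tmp _ _ _ _ _ (fun p : R * R => p.1%:C : R[i]^o)).
    apply: (@continuous_cvg _ _ _ _ _ (fun p : R * R => p.1)).
      exact: real_complex_continuous.
    exact: cvg_fst.
  apply: (@cvgZr_tmp _ _ _ _ _ (fun p : R * R => p.2%:C : R[i]^o)).
  apply: (@continuous_cvg _ _ _ _ _ (fun p : R * R => p.2)).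
    exact: real_complex_continuous.
  exact: cvg_snd.
move=> x x1; have {eM} : `|hdot H x e| <= m%:C.
  by rewrite -MR; apply: (le_trans (eM x)); rewrite ler_piMr.
case ab : (hdot H x e) => [a b].
rewrite normc_def /= lecR => abm.
exists (a, b); last first.
  by rewrite /= ab scalerA -scalerDl; congr (_ *: _); rewrite [RHS]complexE /= mulrC.
split; rewrite /= in_itv /= -ler_norml; apply: le_trans abm;
  by rewrite -sqrtr_sqr ler_wsqrtr// ?lerDl ?lerDr ?sqr_ge0.
Qed.

Lemma bounded_below (A S : bop) : (forall x, A x = 0 -> x = 0) ->
  compact_operator (S * A - 1) ->
  exists2 c : R, 0 < c & forall x, `|x| = 1 -> c%:C <= `|A x|.
Proof.
move=> injA /compact_operatorE [C cC KC].
have [//|nbelow] := pselect (exists2 c : R, 0 < c & forall x, `|x| = 1 -> c%:C <= `|A x|).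
exfalso.
pose E (d : R) := [set z : H | exists x, [/\ `|x| = 1, `|A x| < d%:C & z = (S * A - 1) x]].
have E0 d : 0 < d -> E d !=set0.
  move=> d0; apply/set0P/negP => /eqP Ed0; apply: nbelow; exists d => // x x1.
  rewrite real_leNgt ?normr_real//; last by rewrite ger0_real// ler0c ltW.
  by apply/negP => Axd; have : set0 ((S * A - 1) x) by rewrite -Ed0; exists x.
pose F := filter_from [set d : R | 0 < d] E.
have FF : ProperFilter F.
  apply: filter_from_proper; last by move=> d; exact: E0.
  apply: filter_from_filter; first by exists 1 => /=.
  move=> d d' /= d0 d'0; exists (Num.min d d'); first by rewrite /= lt_min d0.
  move=> z [x [x1 xd ->]]; split; exists x; split=> //;
    by rewrite (lt_le_trans xd)// lecR ge_min lexx ?orbT.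
have FC : F C.
  by exists 1 => //= _ [x [x1 _ ->]]; apply: KC; rewrite x1.
have [y [_ Fy]] := cC F FF FC.
have approx (d : R) : 0 < d ->
    exists x, [/\ `|x| = 1, `|A x| < d%:C & `|y - (S * A - 1) x| < d%:C].
  move=> d0; have [||_ [[x [x1 Axd ->]]]] := Fy (E d) (ball y d%:C).
  - by exists d.
  - by apply: nbhsx_ballx; rewrite ltcR.
  by rewrite -ball_normE /= => yd; exists x.
have [M M0 SM] := bop_ge0 S; have [N N0 AN] := bop_ge0 A.
have near_opp d : 0 < d -> exists x,
    [/\ `|x| = 1, `|A x| < d%:C & `|y + x| <= (1 + M) * d%:C].
  move=> d0; have [x [x1 Axd yd]] := approx d d0; exists x; split=> //.
  have -> : y + x = (y - (S * A - 1) x) + S (A x).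
    by rewrite bopBE bopME bop1E opprB -addrA subrK.
  apply: (le_trans (ler_normD _ _)); rewrite mulrDl mul1r.
  apply: lerD; first exact: ltW.
  by apply: (le_trans (SM _)); rewrite ler_pM2l// ltW.
have MR : M = (complex.Re M)%:C by rewrite RRe_real// gtr0_real.
have NR : N = (complex.Re N)%:C by rewrite RRe_real// gtr0_real.
have yR : `|A y| = (complex.Re `|A y|)%:C by rewrite RRe_real// normr_real.
set m := complex.Re M in MR; set n := complex.Re N in NR.
have m0 : 0 < m by rewrite -ltcR -MR.
have n0 : 0 < n by rewrite -ltcR -NR.
have Ay0 : A y = 0.
  apply/eqP; rewrite -normr_le0 yR lecR; apply/ler_addgt0Pl => e e0; rewrite addr0.
  pose k := n * (1 + m) + 1.
  have k0 : 0 < k by rewrite /k addr_gt0// mulr_gt0// addr_gt0.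
  have [x [x1 Axd yx]] := near_opp (e / k) (divr_gt0 e0 k0).
  rewrite -lecR -yR.
  have -> : A y = A (y + x) - A x by rewrite linearD addrK.
  apply: (le_trans (ler_normB _ _)).
  have -> : e = n * ((1 + m) * (e / k)) + e / k.
    by rewrite mulrA -[X in _ + X]mul1r -mulrDl -/k mulrC divfK// gt_eqF.
  rewrite rmorphD; apply: lerD; last exact: ltW.
  apply: (le_trans (AN _)); rewrite rmorphM/= -NR ler_pM2l//.
  by rewrite rmorphM rmorphD rmorph1 /= -MR.
have y0 := injA _ Ay0.
have k0 : 0 < 1 + m by rewrite addr_gt0.
have [|x [x1 _]] := near_opp (2^-1 / (1 + m)).
  by rewrite divr_gt0// invr_gt0.
rewrite y0 add0r x1 MR -(rmorph1 (real_complex R)) -rmorphD -rmorphM lecR.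
by rewrite mulrC divfK ?gt_eqF// leNgt invf_lt1 ?ltr1n.
Qed.

Lemma bounded_inverse (A S : bop) : (forall x, A x = 0 -> x = 0) ->
  (forall y, exists x, A x = y) -> compact_operator (S * A - 1) ->
  exists B : bop, A * B = 1 /\ B * A = 1.
Proof.
move=> injA surA cK; have [c c0 Ac] := bounded_below injA cK.
have {}injA : injective A.
  by move=> x y Axy; apply/eqP; rewrite -subr_eq0; apply/eqP/injA; rewrite linearB/= Axy subrr.
have [B AB] := choice surA.
have Bb : B \in bounded_linear_pred.
  apply/bounded_linearP; split=> [a x y|].
    by apply: injA; rewrite AB linearP /= !AB.
  exists (c%:C)^-1 => y; rewrite -[in leRHS](AB y).
  have [->|By0] := eqVneq (B y) 0; first by rewrite linear0 !normr0 mulr0.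
  rewrite mulrC ler_pdivlMr ?ltcR// mulrC -ler_pdivlMr ?normr_gt0//.
  have := Ac (`|B y|^-1 *: B y); rewrite linearZ/= !normrZ normfV normr_id.
  by rewrite mulrC [_ * `|A _|]mulrC; apply; rewrite divff// normr_eq0.
exists (Bop Bb); split; apply: bop_eqP => x.
  exact: AB.
by apply: injA; exact: AB.
Qed.

Lemma index0_invertible_lift (T S : bop) :
  fredholm_index T 0 -> compact_operator (S * T - 1) ->
  exists A B : bop, [/\ to_calkin A = to_calkin T, A * B = 1 & B * A = 1].
Proof.
move=> [n [n' [[e [eT edim]] [f fcodim] /esym/eqP]]].
rewrite subr_eq0 eqz_nat => /eqP nn'; move: f fcodim; rewrite -{n'}nn' => f fcodim cST.
pose F : bop := \sum_(i < n) rank1 (e i) (f i).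
have FE x : F x = \sum_(i < n) hdot H x (e i) *: f i.
  by rewrite /F; elim/big_ind2: _ => // U x1 V x2 <- <-.
have AE : to_calkin (T + F) = to_calkin T.
  rewrite raddfD /= raddf_sum big1 /= ?addr0// => i _.
  rewrite -(raddf0 to_calkin); apply/to_calkin_eqP; rewrite subr0.
  exact: rank1_compact.
have ker_hdot x : T x = 0 -> (forall i, hdot H x (e i) = 0) -> x = 0.
  move=> Tx0 xe; apply/eqP; rewrite -(dnorm_eq0 (hdot H)).
  have [c [xE _]] := edim x Tx0.
  rewrite {2}xE linear_sumr /= big1// => i _.
  by rewrite linearZr_LR /= xe mulr0.
have f_uniq (c : 'rV_n) x : T x = \sum_i c 0 i *: f i -> c = 0.
  move=> Tx; have [d [_ dE]] := fcodim (T x).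
  rewrite -(dE c) ?(dE 0)//.
    by rewrite big1 ?subr0; [exists x|move=> i _; rewrite mxE scale0r].
  by rewrite -Tx subrr; exists 0 => //; rewrite linear0.
have e_uniq (c : 'rV_n) : \sum_i c 0 i *: e i = 0 -> c = 0.
  move=> c0; have [d [_ dE]] := edim 0 (linear0 T).
  by rewrite -(dE c) ?(dE 0)// big1// => i _; rewrite mxE scale0r.
have injA x : (T + F) x = 0 -> x = 0.
  rewrite bopDE FE => /eqP; rewrite addr_eq0 -sumrN => /eqP Tx.
  pose c : 'rV_n := \row_i (- hdot H x (e i)).
  have c0 : c = 0.
    by apply: (f_uniq c x); rewrite Tx; apply: eq_bigr => i _; rewrite mxE scaleNr.
  have xe i : hdot H x (e i) = 0.
    by move/rowP/(_ i): c0; rewrite !mxE => /eqP; rewrite oppr_eq0 => /eqP.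
  apply: ker_hdot => //.
  by rewrite Tx big1// => i _; rewrite xe scale0r oppr0.
have surA y : exists x, (T + F) x = y.
  have [c [[z _ Tz] _]] := fcodim y.
  pose G : 'M[R[i]]_n := \matrix_(j, i) hdot H (e j) (e i).
  have GE (a : 'rV_n) i : (a *m G) 0 i = hdot H (\sum_j a 0 j *: e j) (e i).
    rewrite linear_sumlz /= mxE; apply: eq_bigr => j _.
    by rewrite mxE linearZl_LR.
  have Te (a : 'rV_n) : T (\sum_j a 0 j *: e j) = 0.
    by rewrite linear_sum big1// => j _; rewrite linearZ /= eT scaler0.
  have Gu : G \in unitmx.
    rewrite -row_free_unit -kermx_eq0; apply/rowV0P => a /sub_kermxP aG.
    apply: e_uniq; apply: ker_hdot => [|i]; first exact: Te.
    by rewrite -GE aG mxE.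
  pose b : 'rV_n := \row_i (c 0 i - hdot H z (e i)).
  exists (z + \sum_j (b *m invmx G) 0 j *: e j).
  rewrite bopDE linearD /= Te addr0 Tz FE -[RHS](subrK (\sum_i c 0 i *: f i)).
  congr (_ + _); apply: eq_bigr => i _; rewrite linearDl /= -GE mulmxKV//.
  by rewrite mxE addrC subrK.
have [|B [AB BA]] := @bounded_inverse (T + F) S injA surA.
  by apply/to_calkin_eqP; rewrite rmorphM /= AE -rmorphM; apply/to_calkin_eqP.
by exists (T + F), B.
Qed.

Definition U0_pred : {pred calkin} := [pred u | `[< in_U0 u >]].

Record calkin_U0 := CalkinU0 { U0_val :> calkin; _ : U0_val \in U0_pred }.

HB.instance Definition _ := [isSub for U0_val].
HB.instance Definition _ := [Choice of calkin_U0 by <:].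

Lemma U0P u : reflect (in_U0 u) (u \in U0_pred).
Proof. by rewrite inE; apply: asboolP. Qed.

(* Closure of [in_U0] under products and inverses goes through this characterization. *)
Lemma U0_lift u : in_U0 u <-> calkin_unitary u /\
  exists A B : bop, [/\ to_calkin A = u, A * B = 1 & B * A = 1].
Proof.
split=> [[uu [T Tu T0]]|[uu [A [B [Au AB BA]]]]].
  split=> //; have [_ [[_ [S [_ <- _]]] Su _]] := uu.
  rewrite -Tu; apply: (index0_invertible_lift T0 (S := S)).
  by apply/to_calkin_eqP; rewrite rmorphM rmorph1 /= Tu.
by split=> //; exists A => //; exact: invertible_index AB BA.
Qed.

Lemma U0_1 : 1 \in U0_pred.
Proof.
apply/U0P/U0_lift; split; last by exists 1, 1; rewrite mulr1 rmorph1.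
by exists 1; rewrite mulr1; split=> //; exists 1, 1; rewrite rmorph1.
Qed.

Lemma U0_M (u v : calkin_U0) : U0_val u * U0_val v \in U0_pred.
Proof.
have /U0P/U0_lift [uu [A [B [Au AB BA]]]] := valP u.
have /U0P/U0_lift [vu [C [D [Cv CD DC]]]] := valP v.
apply/U0P/U0_lift; split; last first.
  exists (A * C), (D * B); split; first by rewrite rmorphM /= Au Cv.
    by rewrite mulrA -(mulrA A) CD mulr1.
  by rewrite mulrA -(mulrA D) BA mulr1.
have [u' [[T [S [Tu Su TS]]] u'u uu']] := uu.
have [v' [[T' [S' [Tv Sv TS']]] v'v vv']] := vu.
exists (v' * u'); split.
- exists (T * T'), (S' * S); rewrite !rmorphM /= Tu Tv Su Sv; split=> // x y.
  by rewrite !bopME TS TS'.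
- by rewrite mulrA -(mulrA _ _ (U0_val u)) u'u mulr1.
- by rewrite mulrA -(mulrA (U0_val u)) vv' mulr1.
Qed.

Lemma adjoint_sym (T S : bop) : is_adjoint T S -> is_adjoint S T.
Proof.
by move=> TS x y; rewrite (hermC (hdot H) (S x)) (hermC (hdot H) x) /= TS.
Qed.

Lemma U0_V (u : calkin_U0) : exists v : calkin_U0,
  U0_val v * U0_val u = 1 /\ U0_val u * U0_val v = 1.
Proof.
have /U0P/U0_lift [[v [[T [S [Tu Sv TS]]] vu uv]] [A [B [Au AB BA]]]] := valP u.
suff vU : v \in U0_pred by exists (CalkinU0 vU).
apply/U0P/U0_lift; split.
  by exists (U0_val u); split=> //; exists S, T; split=> //; exact: adjoint_sym.
exists B, A; split=> //.
by rewrite -[v]mulr1 -(rmorph1 to_calkin) -AB rmorphM /= Au mulrA vu mul1r.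
Qed.

Definition U0_one : calkin_U0 := CalkinU0 U0_1.
Definition U0_mul (u v : calkin_U0) : calkin_U0 := CalkinU0 (U0_M u v).
Definition U0_inv (u : calkin_U0) : calkin_U0 := projT1 (cid (U0_V u)).

Lemma U0_mulA : associative U0_mul.
Proof. by move=> u v w; apply/val_inj; rewrite /= mulrA. Qed.
Lemma U0_mul1l : left_id U0_one U0_mul.
Proof. by move=> u; apply/val_inj; rewrite /= mul1r. Qed.
Lemma U0_mul1r : right_id U0_one U0_mul.
Proof. by move=> u; apply/val_inj; rewrite /= mulr1. Qed.
Lemma U0_mulVl : left_inverse U0_one U0_inv U0_mul.
Proof. by move=> u; apply/val_inj; rewrite /U0_inv /=; case: cid => v []. Qed.
Lemma U0_mulVr : right_inverse U0_one U0_inv U0_mul.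
Proof. by move=> u; apply/val_inj; rewrite /U0_inv /=; case: cid => v []. Qed.

HB.instance Definition _ := isGroup.Build calkin_U0
  U0_mulA U0_mul1l U0_mul1r U0_mulVl U0_mulVr.

Definition U0_dist (u v : calkin_U0) : R := calkin_norm (U0_val u - U0_val v).

End BoundedOperators.

Section MetricGroupFormulas.
Context (R : realType).

Inductive word :=
  | WVar of nat
  | WOne
  | WMul of word & word
  | WInv of word.

Definition nonneg_orthant n : set 'rV[R]_n := [set v | forall i, 0 <= v ord0 i].

(* A continuous function [0, oo)^n -> [0, oo); its values outside of the orthant are
   irrelevant. *)
Record connective n := Connective {
  connective_fun :> 'rV[R]_n -> R;
  connective_ge0 : forall v, nonneg_orthant v -> 0 <= connective_fun v;
  connective_cont : {within @nonneg_orthant n, continuous connective_fun} }.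

Inductive formula :=
  | FDist of word & word
  | FConn n of connective n & ('I_n -> formula)
  | FSup of nat & formula
  | FInf of nat & formula.

Context (G : groupType) (d : G -> G -> R).
Implicit Types (a : nat -> G) (phi : formula).

Definition update a (x : nat) (g : G) : nat -> G := fun y => if y == x then g else a y.

Fixpoint word_eval (w : word) a : G :=
  match w with
  | WVar x => a x
  | WOne => 1%g
  | WMul s t => (word_eval s a * word_eval t a)%g
  | WInv s => ((word_eval s a)^-1)%g
  end.

(* When [d] is bounded, so are all formulas, and [sup] and [inf] are the true bounds. *)
Fixpoint interp phi a : R :=
  match phi with
  | FDist s t => d (word_eval s a) (word_eval t a)
  | FConn n f psi => f (\row_i interp (psi i) a)
  | FSup x psi => sup [set interp psi (update a x g) | g in [set: G]]
  | FInf x psi => inf [set interp psi (update a x g) | g in [set: G]]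
  end.

(* [(phi, r)] is the condition [phi <= r]; a tuple or sequence is an assignment of
   the variables [0, 1, 2, ...]. *)
Definition type_of a : set (formula * R) :=
  [set p | 0 <= p.2 /\ interp p.1 a <= p.2].

(* The sequence [(a, c)], with the extra entry [c] at index [0]. *)
Definition extend a (c : G) : nat -> G := fun n => if n is k.+1 then a k else c.

Definition countably_homogeneous : Prop :=
  forall a b : nat -> G, type_of a = type_of b ->
  forall c : G, exists e : G, type_of (extend a c) = type_of (extend b e).

End MetricGroupFormulas.

(* Main.v *)
(** Let [e (k, s)], [k] an integer and [s] a natural number, be an orthonormal basis.  The binary
    digits of [s] carry pairwise commuting pairs [Z i], [F i] of anticommuting involutions (the
    sign of digit [i] and the flip of digit [i]), the sign of [k] is an involution [X], and
    [J : k |-> - 1 - k] anticommutes with [X] and commutes with all [Z i], [F i].  The bilateral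
    shift [W j] in [k], restricted to [s < 4 ^ j], commutes exactly with the digits below [2 j]
    and modulo compact operators with [X].

    Let [a = (X, Z 0, F 0, Z 1, F 1, ...)] and [b n = u (a n) u^-1] with [u = W 0 * ... * W (m - 1)],
    which does not depend on [m >= n].  A formula has finitely many variables and conjugation is
    isometric, so [a] and [b] have the same type.  In [(a, J)] the last entry commutes with
    [a 1, a 2, ...] and anticommutes with [a 0 = X]; suppose that [d] does the same for [b].
    With [p = (1 + X) / 2], let [N] be the index of [J d] compressed to the range of [p].  As
    [u J = J u^-1], the element [u J d u = J (u^-1 d u)] commutes with [p] and with the first [m]
    pairs [Z i], [F i], so the index [N - 2 (1 + 4 + ... + 4 ^ (m' - 1))] of its compression is
    divisible by [2 ^ m] ([m' = 2 m] factors in [u]): an element commuting with an anticommuting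
    pair is a product of two conjugate elements, so its index is twice an index.  Hence [3 N + 2]
    is divisible by every power of [2], which is absurd.

    The index of an operator [T] is the trace of [1 - S T] minus that of [1 - T S], for [S] an
    inverse of [T] modulo finite-rank operators. *)

Require Import Defs.
From mathcomp Require Import all_boot all_order all_algebra.
From mathcomp Require Import all_classical all_reals all_analysis.
From mathcomp Require Import complex sesquilinear.
From mathcomp Require Import zify ring.

Set Implicit Arguments.
Unset Strict Implicit.
Unset Printing Implicit Defensive.

Import Order.TTheory GRing.Theory Num.Theory.
Import numFieldNormedType.Exports.

Local Open Scope classical_set_scope.
Local Open Scope ring_scope.
Local Open Scope complex_scope.

(** * Traces of finite-rank maps *)

Section FiniteRankTrace.
Context (K : fieldType) (V : lmodType K).

Definition inspan n (f : 'I_n -> V) (x : V) : Prop :=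
  exists c : 'I_n -> K, x = \sum_i c i *: f i.

Definition lin_indep n (f : 'I_n -> V) : Prop :=
  forall c : 'I_n -> K, \sum_i c i *: f i = 0 -> forall i, c i = 0.

Lemma inspan_mem n (f : 'I_n -> V) i : inspan f (f i).
Proof.
exists (fun j => (j == i)%:R); rewrite (bigD1 i)//= eqxx scale1r big1 ?addr0// => j.
by move=> /negPf ->; rewrite scale0r.
Qed.

Lemma inspan_sum n (f : 'I_n -> V) (I : Type) (r : seq I) (c : I -> K) (x : I -> V) :
  (forall i, inspan f (x i)) -> inspan f (\sum_(i <- r) c i *: x i).
Proof.
move=> fx; apply: (big_ind (inspan f)).
- by exists (fun=> 0); rewrite big1// => i _; rewrite scale0r.
- move=> _ _ [a ->] [b ->]; exists (fun i => a i + b i).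
  by rewrite -big_split; apply: eq_bigr => i _; rewrite scalerDl.
- move=> i _; have [a ->] := fx i; exists (fun j => c i * a j).
  by rewrite scaler_sumr; apply: eq_bigr => j _; rewrite scalerA.
Qed.

Lemma inspan_trans n m (f : 'I_n -> V) (g : 'I_m -> V) x :
  (forall i, inspan g (f i)) -> inspan f x -> inspan g x.
Proof. by move=> gf [c ->]; exact: inspan_sum. Qed.

Lemma inspanD n (f : 'I_n -> V) x y : inspan f x -> inspan f y -> inspan f (x + y).
Proof.
move=> [a ->] [b ->]; exists (fun i => a i + b i).
by rewrite -big_split; apply: eq_bigr => i _; rewrite scalerDl.
Qed.

(** Induction on [n]: the head [A ord0] is adjoined to a basis of the tail exactly when it lies
    outside its span. The last clause keeps [f] inside the span of [A], so that a linear map can be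
    evaluated on [f] through its values on [A]. *)
Lemma basis_extraction n (A : 'I_n -> V) : exists m (f : 'I_m -> V),
  [/\ lin_indep f, forall i, inspan f (A i) & forall j, inspan A (f j)].
Proof.
elim: n A => [|n IHn] A.
  by exists 0%N, A; split=> [c _ []||]//; exact: inspan_mem.
have [m [f [ff fA Af]]] := IHn (A \o lift ord0).
have AA (x : V) : inspan (A \o lift ord0) x -> inspan A x.
  by apply: inspan_trans => i; exact: inspan_mem.
have [fA0|fA0] := pselect (inspan f (A ord0)).
  exists m, f; split=> // [i|j]; last exact/AA.
  by case: (unliftP ord0 i) => [j ->|->//]; exact: fA.
pose g (i : 'I_m.+1) := if unlift ord0 i is Some j then f j else A ord0.
have gsum c : \sum_i c i *: g i = c ord0 *: A ord0 + \sum_i c (lift ord0 i) *: f i.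
  rewrite big_ord_recl /g unlift_none; congr (_ + _).
  by apply: eq_bigr => i _; rewrite liftK.
have gf j : inspan g (f j).
  by have := inspan_mem g (lift ord0 j); rewrite /g liftK.
exists m.+1, g; split=> [c|i|j].
- rewrite gsum; have [c0|c0] := eqVneq (c ord0) 0.
    rewrite c0 scale0r add0r => /ff cl i.
    by case: (unliftP ord0 i) => [j ->|->//].
  move=> /eqP; rewrite addr_eq0 => /eqP cA; exfalso; apply: fA0.
  exists (fun j => - ((c ord0)^-1 * c (lift ord0 j))).
  rewrite -[LHS]scale1r -(mulVf c0) -scalerA cA scalerN scaler_sumr -sumrN.
  by apply: eq_bigr => j _; rewrite scaleNr scalerA.
- case: (unliftP ord0 i) => [j ->|->].
    by apply: inspan_trans (fA j).
  by have := inspan_mem g ord0; rewrite {2}/g unlift_none.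
- rewrite /g; case: (unliftP ord0 j) => [k _|_]; last exact: inspan_mem.
  exact/AA.
Qed.

(** A purely algebraic notion: the functionals [B i] need not be bounded. Independence of the chosen
    representation is [has_trace_uniq]. *)
Definition has_trace (F : V -> V) (t : K) : Prop :=
  exists n (A : 'I_n -> V) (B : 'I_n -> V -> K),
    [/\ forall i, scalar (B i), forall x, F x = \sum_i B i x *: A i
      & t = \sum_i B i (A i)].

Lemma scalar_sum (B : V -> K) (lB : scalar B) I (r : seq I) (c : I -> K) (x : I -> V) :
  B (\sum_(i <- r) c i *: x i) = \sum_(i <- r) c i * B (x i).
Proof.
have B0 : B 0 = 0.
  by apply: (addIr (B 0)); rewrite add0r; have := lB 1 0 0; rewrite scale1r addr0 mul1r.
elim: r => [|i r IHr]; first by rewrite !big_nil.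
by rewrite !big_cons lB IHr.
Qed.

Lemma scalar_lincomb I (r : seq I) (B : I -> V -> K) (c : I -> K) :
  (forall i, scalar (B i)) -> scalar (fun x => \sum_(i <- r) B i x * c i).
Proof.
move=> lB a x y; rewrite mulr_sumr -big_split; apply: eq_bigr => i _.
by rewrite lB mulrDl mulrA.
Qed.

(** Expanding each [A i] in [f] and regrouping changes neither the map nor the trace; this lets a
    representation be moved to an independent family. *)
Lemma trace_rebase n (A : 'I_n -> V) (B : 'I_n -> V -> K) m (f : 'I_m -> V) :
  (forall i, scalar (B i)) -> (forall i, inspan f (A i)) ->
  exists B' : 'I_m -> V -> K, [/\ forall i, scalar (B' i),
    forall x, \sum_i B i x *: A i = \sum_j B' j x *: f j
    & \sum_i B i (A i) = \sum_j B' j (f j)].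
Proof.
move=> lB /choice[a Aa]; exists (fun j x => \sum_i B i x * a i j).
have E x : \sum_i B i x *: A i = \sum_j (\sum_i B i x * a i j) *: f j.
  under [RHS]eq_bigr do rewrite scaler_suml.
  rewrite exchange_big; apply: eq_bigr => i _.
  by rewrite [in LHS]Aa scaler_sumr; apply: eq_bigr => j _; rewrite scalerA.
split=> //; first by move=> j; exact: scalar_lincomb.
rewrite exchange_big; apply: eq_bigr => i _.
by rewrite {1}Aa scalar_sum//; apply: eq_bigr => j _; rewrite mulrC.
Qed.

(** Over an independent family the zero map has only zero coefficients, in particular zero diagonal
    ones. *)
Lemma has_trace_zero F t : has_trace F t -> (forall x, F x = 0) -> t = 0.
Proof.
move=> [n [A [B [lB FE ->]]]] F0.
have [m [f [ff fA _]]] := basis_extraction A.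
have [B' [lB' BE ->]] := trace_rebase lB fA.
rewrite big1// => j _;
have := F0 (f j); rewrite FE BE => /ff; exact.
Qed.

Lemma has_traceD F G t u : has_trace F t -> has_trace G u ->
  has_trace (fun x => F x + G x) (t + u).
Proof.
move=> [n [A [B [lB FE ->]]]] [m [C [D [lD GE ->]]]].
exists (n + m)%N,
  (fun i : 'I_(n + m) => match fintype.split i with inl j => A j | inr j => C j end),
  (fun i : 'I_(n + m) => match fintype.split i with inl j => B j | inr j => D j end).
split=> [i|x|].
- by case: (fintype.split i).
- rewrite big_split_ord /= FE GE; congr (_ + _); apply: eq_bigr => i _.
    by rewrite -[lshift _ _]/(unsplit (inl _)) unsplitK.
  by rewrite -[rshift _ _]/(unsplit (inr _)) unsplitK.
- rewrite big_split_ord /=; congr (_ + _); apply: eq_bigr => i _.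
    by rewrite -[lshift _ _]/(unsplit (inl _)) unsplitK.
  by rewrite -[rshift _ _]/(unsplit (inr _)) unsplitK.
Qed.

Lemma has_traceN F t : has_trace F t -> has_trace (fun x => - F x) (- t).
Proof.
move=> [n [A [B [lB FE ->]]]]; exists n, A, (fun i x => - B i x); split=> [i a x y|x|].
- by rewrite lB opprD mulrN.
- by rewrite FE -sumrN; apply: eq_bigr => i _; rewrite scaleNr.
- by rewrite sumrN.
Qed.

Lemma has_trace_ext F G t : F =1 G -> has_trace F t -> has_trace G t.
Proof. by move=> /funext ->. Qed.

Lemma has_trace_uniq F t u : has_trace F t -> has_trace F u -> t = u.
Proof.
move=> Ft /has_traceN Fu; apply/eqP; rewrite -subr_eq0; apply/eqP.
by apply: has_trace_zero (has_traceD Ft Fu) _ => x; rewrite subrr.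
Qed.

(** Cyclicity of the trace: the same number [\sum_i B i (T (A i))] comes out of both
    compositions. *)
Lemma has_trace_comp F t (T : {linear V -> V}) : has_trace F t ->
  exists u, has_trace (fun x => T (F x)) u /\ has_trace (fun x => F (T x)) u.
Proof.
move=> [n [A [B [lB FE _]]]]; exists (\sum_i B i (T (A i))); split.
  exists n, (fun i => T (A i)), B; split=> // x.
  by rewrite FE linear_sum; apply: eq_bigr => i _; rewrite linearZ.
exists n, A, (fun i x => B i (T x)); split=> // i a x y.
by rewrite linearP lB.
Qed.

(* Both traces are taken over finite-dimensional subspaces [W] and [W'] containing the two ranges,
   chosen such that [T] maps [W] to [W'] and [S] maps [W'] to [W]; since
   [tr (S T) = tr (T S)] there, the difference is [dim W - dim W']. *)
Lemma trace_defect_int (S T : {linear V -> V}) t u :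
  has_trace (fun x => x - S (T x)) t -> has_trace (fun x => x - T (S x)) u ->
  exists z : int, t - u = z%:~R.
Proof.
move=> [n [A [B [lB eE ->]]]] [p [C [D [lD fE ->]]]].
pose A1 (i : 'I_(n + p)) := match fintype.split i with inl j => A j | inr j => S (C j) end.
pose C1 (i : 'I_(n + p)) := match fintype.split i with inl j => T (A j) | inr j => C j end.
have A1l j : inspan A1 (A j).
  have := inspan_mem A1 (unsplit (inl j)); rewrite {2}/A1 unsplitK; exact.
have A1r j : inspan A1 (S (C j)).
  have := inspan_mem A1 (unsplit (inr j)); rewrite {2}/A1 unsplitK; exact.
have C1l j : inspan C1 (T (A j)).
  have := inspan_mem C1 (unsplit (inl j)); rewrite {2}/C1 unsplitK; exact.
have C1r j : inspan C1 (C j).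
  have := inspan_mem C1 (unsplit (inr j)); rewrite {2}/C1 unsplitK; exact.
(* On the second half of the family, [T (S (C j))] differs from [C j] by a value of [1 - T S], which
   is again a combination of the vectors [C]. The next step is symmetric. *)
have TA1 i : inspan C1 (T (A1 i)).
  rewrite /A1; case: (fintype.split i) => j //.
  have -> : T (S (C j)) = C j + (-1) *: (C j - T (S (C j))).
    by rewrite scaleN1r opprB addrC subrK.
  apply: inspanD => //; rewrite fE scaler_sumr.
  under eq_bigr do rewrite scalerA.
  exact: inspan_sum.
have SC1 i : inspan A1 (S (C1 i)).
  rewrite /C1; case: (fintype.split i) => j //.
  have -> : S (T (A j)) = A j + (-1) *: (A j - S (T (A j))).
    by rewrite scaleN1r opprB addrC subrK.
  apply: inspanD => //; rewrite eE scaler_sumr.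
  under eq_bigr do rewrite scalerA.
  exact: inspan_sum.
have lin_span k l (L : {linear V -> V}) (a : 'I_k -> V) (b : 'I_l -> V) x :
    (forall i, inspan b (L (a i))) -> inspan a x -> inspan b (L x).
  move=> ab [c ->]; rewrite linear_sum.
  under eq_bigr do rewrite linearZ /=.
  exact: inspan_sum.
have [r [f [ff fA Af]]] := basis_extraction A1.
have [q [g [gg gC Cg]]] := basis_extraction C1.
have /choice[Y YE] j : inspan g (T (f j)).
  by apply: lin_span (Af j) => i; apply: inspan_trans gC (TA1 i).
have /choice[Z ZE] j : inspan f (S (g j)).
  by apply: lin_span (Cg j) => i; apply: inspan_trans fA (SC1 i).
have [B' [_ BE ->]] := trace_rebase lB (fun i => inspan_trans fA (A1l i)).
have [D' [_ DE ->]] := trace_rebase lD (fun i => inspan_trans gC (C1r i)).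
(* On the basis [a], the functionals [E] give the entries of the identity matrix minus a matrix
   product, so the trace is the dimension minus the trace of that product. *)
have trE k l (L M : {linear V -> V}) (a : 'I_k -> V) (b : 'I_l -> V)
    (y : 'I_k -> 'I_l -> K) (z : 'I_l -> 'I_k -> K) (E : 'I_k -> V -> K) :
    lin_indep a -> (forall j, L (a j) = \sum_i y j i *: b i) ->
    (forall j, M (b j) = \sum_i z j i *: a i) ->
    (forall x, x - M (L x) = \sum_i E i x *: a i) ->
    \sum_i E i (a i) = k%:R - \tr ((\matrix_(i, j) y i j) *m (\matrix_(i, j) z i j)).
  move=> aa Ly Mz EE; rewrite -[in X in X - _](card_ord k) -sum1_card natr_sum.
  rewrite /mxtrace -sumrB; apply: eq_bigr => j _; rewrite mxE.
  have /aa/(_ j) : \sum_i (E i (a j) - ((i == j)%:R - \sum_l0 y j l0 * z l0 i)) *: a i = 0.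
    under eq_bigr do rewrite scalerBl.
    rewrite sumrB -EE; apply/eqP; rewrite subr_eq0; apply/eqP.
    under [RHS]eq_bigr do rewrite scalerBl.
    rewrite sumrB (bigD1 j)//= eqxx scale1r big1 ?addr0 => [|i /negPf ->]; last first.
      by rewrite scale0r.
    congr (_ - _); rewrite Ly linear_sum.
    under [LHS]eq_bigr do rewrite linearZ_LR /= Mz scaler_sumr.
    rewrite exchange_big; apply: eq_bigr => i _; rewrite scaler_suml.
    by apply: eq_bigr => l0 _; rewrite scalerA.
  rewrite eqxx => /eqP; rewrite subr_eq0 => /eqP ->; congr (_ - _).
  by apply: eq_bigr => i _; rewrite !mxE.
have -> := trE _ _ T S f g Y Z B' ff YE ZE (fun x => etrans (eE x) (BE x)).
have -> := trE _ _ S T g f Z Y D' gg ZE YE (fun x => etrans (fE x) (DE x)).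
exists (r%:Z - q%:Z); rewrite [in X in _ - (_ - X)]mxtrace_mulC rmorphB /=.
by rewrite opprB addrA subrK.
Qed.

End FiniteRankTrace.

(** * Finite-rank bounded operators and their trace *)

Section FiniteRankOperators.
Context (R : realType) (H : hilbertSpace R).
Implicit Types (S T F G : bop H).

Definition finite_rank F : Prop := exists t, has_trace F t.

Definition ftrace F : R[i] := xget 0 [set t | has_trace F t].

Lemma has_ftrace F : finite_rank F -> has_trace F (ftrace F).
Proof. by move=> [t Ft]; rewrite /ftrace; case: xgetP => [u -> //|/(_ t)]. Qed.

Lemma ftrace_eq F t : has_trace F t -> ftrace F = t.
Proof. by move=> Ft; apply: (has_trace_uniq _ Ft); apply: has_ftrace; exists t. Qed.

Lemma finite_rankD F G : finite_rank F -> finite_rank G -> finite_rank (F + G).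
Proof. by move=> [t Ft] [u Gu]; exists (t + u); exact: has_traceD Ft Gu. Qed.

Lemma ftraceD F G : finite_rank F -> finite_rank G ->
  ftrace (F + G) = ftrace F + ftrace G.
Proof. by move=> /has_ftrace Ft /has_ftrace Gu; apply: ftrace_eq; exact: has_traceD Ft Gu. Qed.

Lemma finite_rankN F : finite_rank F -> finite_rank (- F).
Proof. by move=> [t Ft]; exists (- t); exact: has_traceN Ft. Qed.

Lemma ftraceN F : finite_rank F -> ftrace (- F) = - ftrace F.
Proof. by move=> /has_ftrace Ft; apply: ftrace_eq; exact: has_traceN Ft. Qed.

Lemma finite_rankB F G : finite_rank F -> finite_rank G -> finite_rank (F - G).
Proof. by move=> fF fG; apply: finite_rankD => //; exact: finite_rankN. Qed.

Lemma ftraceB F G : finite_rank F -> finite_rank G ->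
  ftrace (F - G) = ftrace F - ftrace G.
Proof. by move=> fF fG; rewrite ftraceD ?ftraceN//; exact: finite_rankN. Qed.

Lemma has_trace_bopM T F t : has_trace F t ->
  exists u, has_trace (T * F) u /\ has_trace (F * T) u.
Proof. by move=> Ft; have [u [TF FT]] := @has_trace_comp _ _ _ _ T Ft; exists u. Qed.

Lemma finite_rankMl T F : finite_rank F -> finite_rank (T * F).
Proof. by move=> [t Ft]; have [u [TF _]] := has_trace_bopM T Ft; exists u. Qed.

Lemma finite_rankMr T F : finite_rank F -> finite_rank (F * T).
Proof. by move=> [t Ft]; have [u [_ FT]] := has_trace_bopM T Ft; exists u. Qed.

Lemma ftraceMC T F : finite_rank F -> ftrace (T * F) = ftrace (F * T).
Proof.
by move=> [t Ft]; have [u [/ftrace_eq -> /ftrace_eq ->]] := has_trace_bopM T Ft.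
Qed.

Lemma finite_rank0 : finite_rank 0.
Proof.
exists 0, 0%N, (fun=> 0), (fun=> fun=> 0); split=> [[]//|x|]; last by rewrite big_ord0.
by rewrite big_ord0.
Qed.

Lemma ftrace0 : ftrace 0 = 0.
Proof.
apply: (@addrI _ (ftrace 0)).
by rewrite -ftraceD ?addr0//; exact: finite_rank0.
Qed.

Lemma scalar_hdot (e : H) : scalar (fun x => hdot H x e).
Proof. by move=> a x y; rewrite linearPl. Qed.

Lemma has_trace_rank1 (e f : H) : has_trace (rank1 e f) (hdot H f e).
Proof.
exists 1%N, (fun=> f), (fun=> fun x => hdot H x e); split=> [_|x|].
- exact: scalar_hdot.
- by rewrite big_ord1.
- by rewrite big_ord1.
Qed.

End FiniteRankOperators.

(** * Hilbert bases *)

Section OrthonormalBasis.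
Context (R : realType) (H : hilbertSpace R).
Implicit Types (e : nat -> H) (x y : H).

Definition on_upto e n : Prop :=
  forall i j, (i < n)%N -> (j < n)%N -> hdot H (e i) (e j) = (i == j)%:R.

Definition orthonormal e : Prop := forall i j, hdot H (e i) (e j) = (i == j)%:R.

Lemma orthonormal_upto e n : orthonormal e -> on_upto e n.
Proof. by move=> oe i j _ _; exact: oe. Qed.

Definition fourier e n x : H := \sum_(i < n) hdot H x (e i) *: e i.

Lemma hdot_lincomb e n (c : nat -> R[i]) j : on_upto e n ->
  (j < n)%N -> hdot H (\sum_(i < n) c i *: e i) (e j) = c j.
Proof.
move=> oe jn; rewrite linear_sumlz /= (bigD1 (Ordinal jn))//= linearZl_LR /= oe// eqxx mulr1.
rewrite big1 ?addr0// => i ij; rewrite linearZl_LR /= oe//.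
by rewrite -[j]/(nat_of_ord (Ordinal jn)) val_eqE (negPf ij) mulr0.
Qed.

Lemma norm_sqr_lincomb e n (c : nat -> R[i]) : on_upto e n ->
  `|\sum_(i < n) c i *: e i| ^+ 2 = \sum_(i < n) `|c i| ^+ 2.
Proof.
move=> oe; rewrite -hdot_norm linear_sumr /=; apply: eq_bigr => i _.
by rewrite linearZr_LR /= hdot_lincomb// mulrC -normCK.
Qed.

Lemma hdot_fourier e n x j : on_upto e n -> (j < n)%N ->
  hdot H (fourier e n x) (e j) = hdot H x (e j).
Proof. by move=> oe jn; rewrite (hdot_lincomb (fun i => hdot H x (e i)) oe). Qed.

Lemma hdot_fourier_next e n x : on_upto e n.+1 -> hdot H (fourier e n x) (e n) = 0.
Proof.
move=> oe; rewrite linear_sumlz /= big1// => i _; rewrite linearZl_LR /=.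
have ni : (i < n.+1)%N by rewrite ltnS ltnW.
by rewrite (oe _ _ ni (ltnSn n)) (ltn_eqF (ltn_ord i)) mulr0.
Qed.

Lemma fourier_pythagoras e n x : on_upto e n ->
  `|x| ^+ 2 = `|fourier e n x| ^+ 2 + `|x - fourier e n x| ^+ 2.
Proof.
move=> oe; have o : hdot H (x - fourier e n x) (fourier e n x) = 0.
  rewrite {2}/fourier linear_sumr /= big1// => i _.
  by rewrite linearZr_LR /= linearBl /= hdot_fourier// subrr mulr0.
have -> : `|x| ^+ 2 = `|(x - fourier e n x) + fourier e n x| ^+ 2 by rewrite subrK.
by rewrite -!hdot_norm dnormD o add0r rmorph0 addr0 addrC.
Qed.

Lemma fourierB e n x y : fourier e n (x - y) = fourier e n x - fourier e n y.
Proof.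
by rewrite /fourier -sumrB; apply: eq_bigr => i _; rewrite linearBl /= scalerBl.
Qed.

Lemma norm_sub_fourier e n x : on_upto e n -> `|x - fourier e n x| <= `|x|.
Proof.
move=> oe; rewrite -(@ler_pXn2r _ 2)// ?nnegrE//.
by rewrite [leRHS](fourier_pythagoras x oe) lerDr exprn_ge0.
Qed.

(** The residual of [x] equals the residual of [x - y], and taking residuals does not increase
    norms. *)
Lemma fourier_best e n x y : on_upto e n -> fourier e n y = y ->
  `|x - fourier e n x| <= `|x - y|.
Proof.
move=> oe yE; have -> : x - fourier e n x = (x - y) - fourier e n (x - y).
  by rewrite fourierB yE opprB addrA subrK.
exact: norm_sub_fourier.
Qed.

Lemma fourierS e n x : fourier e n.+1 x = fourier e n x + hdot H x (e n) *: e n.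
Proof. by rewrite /fourier big_ord_recr. Qed.

Lemma dense_sequence : separable_space H ->
  exists d : nat -> H, forall x (eps : R[i]), 0 < eps -> exists k, `|x - d k| < eps.
Proof.
move=> [D /countable_injP[f finj] dD].
exists (fun n => xget 0 [set x | D x /\ f x = n]) => x eps eps0.
have [||y [/= xy Dy]] := dD (interior (ball x eps)).
- by exists x; exact: nbhsx_ballx.
- exact: open_interior.
exists (f y); have [Dz fz] := xgetPex 0 (ex_intro [set x | D x /\ f x = f y] y (conj Dy erefl)).
rewrite (finj _ _ (mem_set Dz) (mem_set Dy) fz).
by move/interior_subset: xy; rewrite -ball_normE.
Qed.

(** * Gram-Schmidt orthonormalization of a dense sequence *)

Section GramSchmidt.
Variable d : nat -> H.

Definition residual (s : seq H) x : H := x - \sum_(v <- s) hdot H x v *: v.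

(** Vectors already in the span are skipped: the first [d k] with a nonzero residual is normalized.
    The value 0 is excluded later by infinite dimension. *)
Definition gs_next (s : seq H) : H :=
  match pselect (exists k, residual s (d k) != 0) with
  | left P => let v := residual s (d (ex_minn P)) in `|v|^-1 *: v
  | right _ => 0
  end.

Definition gs_seq n : seq H := iter n (fun s => rcons s (gs_next s)) [::].

Definition gs n : H := gs_next (gs_seq n).

Lemma residual_gs n x : residual (gs_seq n) x = x - fourier gs n x.
Proof.
rewrite /residual; suff -> : \sum_(v <- gs_seq n) hdot H x v *: v = fourier gs n x by [].
elim: n => [|n IHn]; first by rewrite /= big_nil /fourier big_ord0.
by rewrite fourierS -IHn /= big_rcons /=.
Qed.

Lemma gsE n : (exists k, d k - fourier gs n (d k) != 0) ->
  exists k, [/\ d k - fourier gs n (d k) != 0,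
    forall l, d l - fourier gs n (d l) != 0 -> (k <= l)%N
    & gs n = `|d k - fourier gs n (d k)|^-1 *: (d k - fourier gs n (d k))].
Proof.
move=> [k0 k0P]; have -> : gs n = gs_next (gs_seq n) by [].
rewrite /gs_next; case: pselect => [P|[]]; last first.
  by exists k0; rewrite residual_gs.
case: ex_minnP => k kP kmin; exists k; rewrite -residual_gs; split=> // l lP.
by apply: kmin; rewrite residual_gs.
Qed.

Hypothesis d_dense : forall x (eps : R[i]), 0 < eps -> exists k, `|x - d k| < eps.
Hypothesis dim_inf : infinite_dimensional H.

(** Otherwise every [d k] is in the span of the first [n] vectors; by density and best approximation
    so is every [x], and the space has dimension [n]. *)
Lemma gs_residual_exists n : on_upto gs n -> exists k, d k - fourier gs n (d k) != 0.
Proof.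
move=> og; have [//|nk] := pselect (exists k, d k - fourier gs n (d k) != 0).
exfalso; have dE k : fourier gs n (d k) = d k.
  have [/eqP|k0] := eqVneq (d k - fourier gs n (d k)) 0.
    by rewrite subr_eq0 => /eqP.
  by exfalso; apply: nk; exists k.
have xE x : x = fourier gs n x.
  have [/eqP|x0] := eqVneq (x - fourier gs n x) 0; first by rewrite subr_eq0 => /eqP.
  have [|k] := @d_dense x `|x - fourier gs n x|; first by rewrite normr_gt0.
  by move=> /(le_lt_trans (fourier_best x og (dE k))); rewrite ltxx.
apply: (dim_inf (n := n)); exists (fun i : 'I_n => gs i); split=> // x _.
exists (\row_i hdot H x (gs i)); split.
  by rewrite [LHS]xE; apply: eq_bigr => i _; rewrite mxE.
move=> c cE; apply/rowP => i; rewrite mxE cE linear_sumlz /= (bigD1 i)//= linearZl_LR /= og//.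
rewrite eqxx mulr1 big1 ?addr0// => j ji.
by rewrite linearZl_LR /= og// val_eqE (negPf ji) mulr0.
Qed.

Lemma gs_on_upto n : on_upto gs n.
Proof.
elim: n => [//|n IHn].
have [k [k0 _ gE]] := gsE (gs_residual_exists IHn).
set v := d k - _ in k0 gE.
have og i : (i < n)%N -> hdot H (gs n) (gs i) = 0.
  by move=> ni; rewrite gE linearZl_LR /= /v linearBl /= hdot_fourier// subrr mulr0.
have gg : hdot H (gs n) (gs n) = 1.
  by rewrite hdot_norm gE normrZ normfV normr_id mulVf ?expr1n// normr_eq0.
move=> i j; rewrite !ltnS [(i <= n)%N]leq_eqVlt [(j <= n)%N]leq_eqVlt.
move=> /predU1P[->|ni] /predU1P[->|nj].
- by rewrite gg eqxx.
- by rewrite og// (gtn_eqF nj).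
- by rewrite hermC /= og// rmorph0 mulr0 (ltn_eqF ni).
- exact: IHn.
Qed.

(** When [d 0], ..., [d (n - 1)] are in the span of the first [n] vectors, [d n] either is there too
    or is the first vector outside, hence the one chosen for [gs n]. *)
Lemma gs_span n k : (k < n)%N -> fourier gs n (d k) = d k.
Proof.
elim: n k => [//|n IHn] k; rewrite ltnS leq_eqVlt fourierS => kn.
have on := @gs_on_upto n.+1.
have ortho x : fourier gs n x = x -> fourier gs n x + hdot H x (gs n) *: gs n = x.
  move=> xE; suff -> : hdot H x (gs n) = 0 by rewrite scale0r addr0.
  by rewrite -xE hdot_fourier_next.
have [/eqP|r0] := eqVneq (d k - fourier gs n (d k)) 0.
  by rewrite subr_eq0 => /eqP/esym/ortho.
have kE : k = n.
  by case/predU1P: kn => // kn; move: r0; rewrite IHn// subrr eqxx.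
rewrite kE in r0 *.
have [l [l0 lmin gE]] := gsE (gs_residual_exists (@gs_on_upto n)).
have lE : l = n.
  apply/eqP; rewrite eqn_leq lmin//= leqNgt; apply/negP => ln.
  by move: l0; rewrite IHn// subrr eqxx.
rewrite lE in gE; set v := d n - fourier gs n (d n) in r0 gE.
have dv : d n = v + fourier gs n (d n) by rewrite /v subrK.
suff -> : hdot H (d n) (gs n) *: gs n = v by rewrite addrC -dv.
have -> : hdot H (d n) (gs n) = hdot H v (gs n).
  by rewrite {1}dv linearDl /= hdot_fourier_next// addr0.
have vn0 : `|v| != 0 by rewrite normr_eq0.
rewrite gE linearZr_LR /= hdot_norm scalerA.
rewrite conj_Creal ?rpredV ?normr_real// expr2 mulrA mulVf// mul1r divff//.
by rewrite scale1r.
Qed.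

End GramSchmidt.

Definition orthonormal_basis e : Prop := orthonormal e /\
  forall x, fourier e n x @[n --> \oo] --> x.

Lemma orthonormal_basis_exists : separable_space H -> infinite_dimensional H ->
  exists e, orthonormal_basis e.
Proof.
move=> /dense_sequence[d dd] Hinf; exists (gs d).
have og : orthonormal (gs d).
  move=> i j; apply: (@gs_on_upto d dd Hinf (maxn i j).+1); rewrite ltnS.
    exact: leq_maxl.
  exact: leq_maxr.
split=> // x; apply/cvgrPdist_lt => eps eps0; have [k xk] := dd x eps eps0.
exists k.+1 => // n /= kn; apply: le_lt_trans xk; apply: fourier_best.
  exact: orthonormal_upto.
exact: gs_span.
Qed.

End OrthonormalBasis.

(** * Isometries defined on an orthonormal basis *)

Section BasisOperators.
Context (R : realType) (H : hilbertSpace R).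
Implicit Types (e : nat -> H) (x y : H) (S T : bop H).

Lemma cvg_of_cauchy (u : nat -> H) :
  (forall eps : R[i], 0 < eps -> exists N, forall n, (N <= n)%N -> `|u N - u n| < eps) ->
  cvg (u n @[n --> \oo]).
Proof.
move=> cu; apply/cauchy_cvgP/cauchy_exP => eps eps0.
have [N uN] := cu eps eps0; exists (u N), N => // n /= Nn.
by rewrite -ball_normE /=; exact: uN.
Qed.

Lemma lincombB e (c : nat -> R[i]) m n : (m <= n)%N ->
  \sum_(i < m) c i *: e i - \sum_(i < n) c i *: e i =
  \sum_(i < n) (if (i < m)%N then 0 else - c i) *: e i.
Proof.
move=> mn; rewrite (big_ord_widen n (fun i => c i *: e i) mn) big_mkcond -sumrB.
by apply: eq_bigr => i _; case: ifP; rewrite ?subrr ?scale0r// sub0r scaleNr.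
Qed.

Lemma norm_lincomb_eq e e' n (c : nat -> R[i]) : on_upto e n -> on_upto e' n ->
  `|\sum_(i < n) c i *: e i| = `|\sum_(i < n) c i *: e' i|.
Proof.
move=> oe oe'; apply/eqP; rewrite -(@eqrXn2 _ 2)//.
by rewrite !norm_sqr_lincomb.
Qed.

(** The value [U x] is the limit of the Fourier sums of [x] with [e'] substituted for [e]. Norms of
    linear combinations agree over the two families, so these sums are Cauchy and their limit has
    the norm of [x]. *)
Lemma basis_isometry e e' : orthonormal_basis e -> orthonormal e' ->
  exists U : bop H, (forall x, `|U x| = `|x|) /\ forall n, U (e n) = e' n.
Proof.
move=> [oe eP] oe'; pose S n x : H := \sum_(i < n) hdot H x (e i) *: e' i.
have SP n x : `|S n x| = `|fourier e n x|.
  by apply: (norm_lincomb_eq (fun i => hdot H x (e i))); exact: orthonormal_upto.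
have Scvg x : cvg (S n x @[n --> \oo]).
  apply: cvg_of_cauchy => eps eps0.
  have /cvgrPdist_lt/(_ (eps / 2) (divr_gt0 eps0 (ltr0n _ 2)))[N _ PN] := eP x.
  exists N => n Nn; rewrite /S (lincombB e' (fun i => hdot H x (e i)) Nn).
  pose c i := if (i < N)%N then 0 else - hdot H x (e i).
  rewrite -(norm_lincomb_eq (e := e) c); [|exact: orthonormal_upto..].
  rewrite -(lincombB e (fun i => hdot H x (e i)) Nn) (splitr eps).
  rewrite -[X in `|X|](subrKA x) -opprB.
  apply: (le_lt_trans (ler_normD _ _)); rewrite normrN.
  by apply: ltrD; apply: PN => /=.
pose U x : H := lim (S n x @[n --> \oo]).
have SU x : S n x @[n --> \oo] --> U x by exact: Scvg.
have Ulim x y : S n x @[n --> \oo] --> y -> U x = y.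
  by move=> /cvg_lim; apply; exact: norm_hausdorff.
have UN x : `|U x| = `|x|.
  apply: (@cvg_unique R[i]^o _ (`|S n x| @[n --> \oo])).
  - exact: norm_hausdorff.
  - exact: cvg_norm.
  - have -> : (fun n => `|S n x|) = (fun n => `|fourier e n x|) by apply/funext => n; exact: SP.
    exact: cvg_norm.
have Ub : U \in @bounded_linear_pred R H.
  apply/bounded_linearP; split; last by exists 1 => x; rewrite UN mul1r.
  move=> a x y; apply: Ulim.
  have -> : (fun n => S n (a *: x + y)) = (fun n => a *: S n x + S n y).
    apply/funext => n; rewrite /S scaler_sumr -big_split; apply: eq_bigr => i _.
    by rewrite linearPl /= scalerDl scalerA.
  by apply: cvgD => //; apply: cvgZl_tmp.
exists (Bop Ub); split=> // n; apply: Ulim.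
apply: cvg_near_cst; exists n.+1 => // m /= nm.
rewrite /S (bigD1 (Ordinal nm))//= oe eqxx scale1r big1 ?addr0// => i ij.
rewrite oe -[n]/(nat_of_ord (Ordinal nm)) val_eqE eq_sym (negPf ij).
by rewrite scale0r.
Qed.

Lemma bop_eq_basis e S T : orthonormal_basis e -> (forall n, S (e n) = T (e n)) -> S = T.
Proof.
move=> [oe eP] ST; apply: bop_eqP => x.
have SF (U : bop H) : U (fourier e n x) @[n --> \oo] --> U x.
  by apply: (@cvg_comp _ _ _ (fun n => fourier e n x) U); [exact: eP|exact: bop_continuous].
apply: (@cvg_unique H _ (S (fourier e n x) @[n --> \oo])).
- exact: norm_hausdorff.
- exact: SF.
- suff -> : (fun n => S (fourier e n x)) = (fun n => T (fourier e n x)) by exact: SF.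
  apply/funext => n; rewrite !linear_sum; apply: eq_bigr => i _.
  by rewrite !linearZ /= ST.
Qed.

(** Polarization: norms determine the real part of [hdot H u v], and the real part for [u] and
    ['i *: v] gives the imaginary part. *)
Lemma isometry_adjoint S T : (forall x, `|S x| = `|x|) -> S * T = 1 -> is_adjoint S T.
Proof.
move=> SN ST x y.
have Sdot u v : hdot H (S u) (S v) = hdot H u v.
  have re w z : hdot H (S w) (S z) + (hdot H (S w) (S z))^*%R =
      hdot H w z + (hdot H w z)^*%R.
    apply: (addrI (`|w| ^+ 2 + `|z| ^+ 2)).
    have := dnormD (hdot H) w z; rewrite /= !hdot_norm => <-.
    have := dnormD (hdot H) (S w) (S z); rewrite /= !hdot_norm !SN => <-.
    by rewrite -linearD SN.
  have := re u ('i *: v); rewrite linearZ /= !linearZr_LR /= !rmorphM /= !conjCK.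
  rewrite conjCi !mulNr => /(congr1 (fun t => 'i * t)).
  rewrite !mulrDr !mulrN !mulrA -!expr2 sqrCi !mulN1r !opprK => im.
  have := re u v => re1; have t0 : 2 != 0 :> R[i] by rewrite pnatr_eq0.
  apply: (mulfI t0).
  move: re1 im; set p := hdot H (S u) (S v); set q := hdot H u v.
  move: (p^*%R) (q^*%R) => p' q' re1 im.
  have -> : 2 * p = (p + p') + (p - p') by ring.
  by rewrite re1 im; ring.
by rewrite -[y in LHS]bop1E -ST bopME Sdot.
Qed.

End BasisOperators.

(** * Compact operators and the Fredholm index *)

Section CompactOperators.
Context (R : realType) (H : hilbertSpace R).
Implicit Types (e : nat -> H) (x y : H) (S T : bop H).

Lemma bop_sumE (I : Type) (r : seq I) (T : I -> bop H) x :
  (\sum_(i <- r) T i) x = \sum_(i <- r) T i x.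
Proof. by elim: r => [|i r IHr]; rewrite ?big_nil// !big_cons bopDE IHr. Qed.

Definition fproj e n : bop H := \sum_(i < n) rank1 (e i) (e i).

Lemma fprojE e n x : fproj e n x = fourier e n x.
Proof. exact: bop_sumE. Qed.

Lemma finite_rank_sum (I : Type) (r : seq I) (T : I -> bop H) :
  (forall i, finite_rank (T i)) -> finite_rank (\sum_(i <- r) T i).
Proof.
move=> fT; apply: big_ind => //; first exact: finite_rank0.
by move=> F G; exact: finite_rankD.
Qed.

Lemma ftrace_sum (I : Type) (r : seq I) (T : I -> bop H) :
  (forall i, finite_rank (T i)) -> ftrace (\sum_(i <- r) T i) = \sum_(i <- r) ftrace (T i).
Proof.
move=> fT; elim: r => [|i r IHr]; first by rewrite !big_nil ftrace0.
by rewrite !big_cons ftraceD ?IHr//; exact: finite_rank_sum.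
Qed.

Lemma finite_rank_rank1 (u v : H) : finite_rank (rank1 u v).
Proof. by exists (hdot H v u); exact: has_trace_rank1. Qed.

Lemma small_of_ball (T : bop H) (eps : R[i]) :
  (forall x, `|x| <= 1 -> `|T x| <= eps) -> forall x, `|T x| <= eps * `|x|.
Proof.
move=> Teps x; have [->|x0] := eqVneq x 0; first by rewrite linear0 !normr0 mulr0.
have xp : 0 < `|x| by rewrite normr_gt0.
have := Teps (`|x|^-1 *: x); rewrite linearZ /= !normrZ normfV normr_id mulVf ?gt_eqF//.
by move=> /(_ (lexx _)); rewrite mulrC ler_pdivrMr.
Qed.

Lemma norm_halves_small (r eps : R[i]) : 0 <= r -> 0 < eps ->
  exists N, forall n, (N <= n)%N -> 2^-1 ^+ n * r < eps.
Proof.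
move=> r0 e0; pose a := complex.Re (r / eps).
have aE : a%:C = r / eps by rewrite RRe_real// ger0_real// divr_ge0// ltW.
have a0 : 0 <= a by rewrite -ler0c aE divr_ge0// ltW.
exists (Num.bound a) => n an; rewrite exprVn mulrC ltr_pdivrMr ?exprn_gt0//.
rewrite mulrC -ltr_pdivrMr// -aE -[2]/(2%:R) -natrX -(rmorph_nat (@real_complex R)) ltcR.
apply: (lt_le_trans (archi_boundP a0)); rewrite ler_nat.
by apply: (leq_trans an); apply: ltnW; exact: ltn_expl.
Qed.

Lemma neumann_inverse (M : bop H) : (forall x, `|M x| <= 2^-1 * `|x|) ->
  exists B : bop H, (1 + M) * B = 1 /\ B * (1 + M) = 1.
Proof.
move=> Mh; have half0 : 0 <= 2^-1 :> R[i] by rewrite invr_ge0.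
have solve y : exists x, x + M x = y /\ `|x| <= 2 * `|y|.
  (* The partial sums of the Neumann series for the inverse of [1 + M], applied to [y]. *)
  pose u := fix u n := if n is m.+1 then y - M (u m) else 0 : H.
  have uS n : u n.+1 = y - M (u n) by [].
  have ub n : `|u n| <= 2 * `|y|.
    elim: n => [|n IHn]; first by rewrite normr0 mulr_ge0.
    rewrite uS; apply: (le_trans (ler_normB _ _)); rewrite mulr_natl mulr2n lerD2l.
    apply: (le_trans (Mh _)); apply: (le_trans (ler_wpM2l half0 IHn)).
    by rewrite mulrA mulVf ?mul1r// pnatr_eq0.
  have ud N n : (N <= n)%N -> `|u N - u n| <= 2^-1 ^+ N * (2 * `|y|).
    elim: N n => [|N IHN] n; first by rewrite expr0 mul1r sub0r normrN.
    case: n => [//|n]; rewrite ltnS => Nn.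
    have -> : u N.+1 - u n.+1 = - M (u N - u n).
      by rewrite !uS [M (u N - u n)]linearB /= !opprB addrC addrA subrK.
    by rewrite normrN exprS -mulrA; apply: (le_trans (Mh _)); rewrite ler_wpM2l// IHN.
  have ucvg : cvg (u n @[n --> \oo]).
    apply: cvg_of_cauchy => eps eps0.
    have [|N uN] := @norm_halves_small (2 * `|y|) eps _ eps0; first by rewrite mulr_ge0.
    by exists N => n Nn; apply: le_lt_trans (ud N n Nn) (uN N (leqnn N)).
  pose x := lim (u n @[n --> \oo]).
  have ux : u n @[n --> \oo] --> x by exact: ucvg.
  have xE : x = y - M x.
    apply: (@cvg_unique H _ (u n.+1 @[n --> \oo])); first exact: norm_hausdorff.
    - by rewrite -(@cvg_shiftS H) in ux.
    - apply: cvgB; first exact: cvg_cst.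
      by apply: (@cvg_comp _ _ _ u M); [exact: ux|exact: bop_continuous].
  exists x; split; first by rewrite {1}xE subrK.
  have : `|x| <= `|y| + 2^-1 * `|x|.
    by rewrite {1}xE; apply: (le_trans (ler_normB _ _)); rewrite lerD2l.
  rewrite -lerBlDr -{1}[`|x|]mul1r -mulrBl.
  have -> : 1 - 2^-1 = 2^-1 :> R[i] by rewrite [X in X - _](splitr 1) mul1r addrK.
  by rewrite mulrC ler_pdivrMr// mulrC.
have [B BP] := choice solve.
have inj x x' : x + M x = x' + M x' -> x = x'.
  move=> E; apply/eqP; rewrite -subr_eq0 -normr_le0.
  have E' : x - x' = - M (x - x').
    by apply/eqP; rewrite -addr_eq0 linearB /= addrACA -opprD E subrr.
  have := Mh (x - x'); rewrite -normrN -E' => h.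
  have : `|x - x'| - 2^-1 * `|x - x'| <= 0 by rewrite subr_le0.
  rewrite -{1}[`|_ - _|]mul1r -mulrBl.
  have -> : 1 - 2^-1 = 2^-1 :> R[i] by rewrite [X in X - _](splitr 1) mul1r addrK.
  by rewrite pmulr_rle0// invr_gt0.
have Bb : B \in @bounded_linear_pred R H.
  apply/bounded_linearP; split; last by exists 2 => y; case: (BP y).
  move=> a y z; apply: inj; case: (BP (a *: y + z)) => -> _.
  rewrite linearP /= addrACA -scalerDr.
  by case: (BP y) => -> _; case: (BP z) => -> _.
exists (Bop Bb); split; apply: bop_eqP => y; first by case: (BP y).
by apply: inj; case: (BP ((1 + M) y)).
Qed.

(** If it fails for every [n], there are [z n] in the unit ball at which the tail of [L (z n)]
    exceeds [eps]. Let [y] be a cluster point of [L (z n)]: the tail of [y] tends to 0, and the tail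
    of [y - L (z n)] is at most its norm. *)
Lemma compact_fproj e (L : bop H) (eps : R[i]) : orthonormal_basis e ->
  compact_operator L -> 0 < eps ->
  exists n, forall x, `|(L - fproj e n * L) x| <= eps * `|x|.
Proof.
move=> [oe eP] /compact_operatorE[C cC LC] eps0.
have [//|nsmall] := pselect (exists n, forall x, `|(L - fproj e n * L) x| <= eps * `|x|).
exfalso.
have /choice[z zP] n : exists z, `|z| <= 1 /\ ~~ (`|(L - fproj e n * L) z| <= eps).
  have [//|nz] := pselect (exists z, `|z| <= 1 /\ ~~ (`|(L - fproj e n * L) z| <= eps)).
  exfalso; apply: nsmall; exists n; apply: small_of_ball => x x1.
  by apply/negPn/negP => Lx; apply: nz; exists x.
have [|y [_ yP]] := cC (L (z n) @[n --> \oo]) _.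
  by exists 0%N => // n _; apply: LC; case: (zP n).
have e20 : 0 < eps / 2 by rewrite divr_gt0.
have /cvgrPdist_lt/(_ _ e20)[N _ yN] := eP y.
have tailN : (L (z n) @[n --> \oo]) [set L (z n) | n in [set n | (N <= n)%N]].
  by exists N => // n /= Nn; exists n.
have [w [[n /= Nn <-] yw]] := yP _ _ tailN (nbhsx_ballx y _ e20).
move: yw; rewrite -ball_normE /= => yw; case: (zP n) => _ /negP; apply.
rewrite bopBE bopME fprojE.
have -> : L (z n) - fourier e n (L (z n)) =
    (y - fourier e n y) - ((y - L (z n)) - fourier e n (y - L (z n))).
  by rewrite fourierB !opprB [RHS]addrA subrKA [RHS]addrC subrKA.
rewrite (splitr eps); apply: (le_trans (ler_normB _ _)); apply: lerD.
  by apply: ltW; apply: yN.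
have h := norm_sub_fourier (y - L (z n)) (orthonormal_upto (n := n) oe).
by apply: le_trans h _; exact: ltW.
Qed.

(** With [P] a basis projection such that [L - P L] has norm at most one half, [1 + (L - P L)] is
    invertible and [P L] has finite rank. *)
Lemma compact_decomposition (L : bop H) : separable_space H -> infinite_dimensional H ->
  compact_operator L ->
  exists A B F : bop H, [/\ 1 + L = A + F, finite_rank F, A * B = 1 & B * A = 1].
Proof.
move=> Hsep Hinf cL; have [e eb] := orthonormal_basis_exists Hsep Hinf.
have h0 : 0 < 2^-1 :> R[i] by rewrite invr_gt0.
have [n Ln] := compact_fproj eb cL h0.
have [B [AB BA]] := neumann_inverse Ln.
exists (1 + (L - fproj e n * L)), B, (fproj e n * L); split=> //.
  by rewrite addrA subrK.
by apply: finite_rankMr; apply: finite_rank_sum => i; exact: finite_rank_rank1.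
Qed.

(** Total boundedness and completeness: an ultrafilter on the closure is Cauchy because its image in
    a nearby compact set has a cluster point. *)
Lemma compact_closure (A : set H) :
  (forall eps : R[i], 0 < eps -> exists2 C : set H, compact C &
     forall y, A y -> exists2 z, C z & `|y - z| <= eps) ->
  compact (closure A).
Proof.
move=> Aeps; rewrite compact_ultra => F UF FA.
have FF : ProperFilter F by exact: ultra_proper.
suff Fc : cvg F.
  exists (lim F); split; last exact: Fc.
  exact: (@closed_cvg _ _ F _ id (closure A) (@closed_closure _ A) FA (lim F) Fc).
apply/cauchy_cvgP/cauchy_exP => eps eps0.
have e30 : 0 < eps / 3 by rewrite divr_gt0.
have [C cC AC] := Aeps _ e30.
(* One third leads from the closure to [A], another from [A] to [C]; the last is kept for the
   distance to the cluster point. *)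
have /choice[g gP] y : exists z, closure A y -> C z /\ `|y - z| < eps / 3 + eps / 3.
  have [yA|nyA] := pselect (closure A y); last by exists 0.
  have [w [Aw yw]] := yA _ (nbhsx_ballx y _ e30); have [z Cz wz] := AC w Aw.
  exists z => _; split=> //; rewrite -(subrKA w).
  apply: (le_lt_trans (ler_normD _ _)); apply: ltr_leD => //.
  by move: yw; rewrite -ball_normE.
have gF : (g @ F) C by apply: (@filterS _ F _ _ _ _ FA) => y Ay; have [] := gP y Ay.
have [p [_ pF]] := cC (g @ F) _ gF.
(* The ultrafilter contains the ball or its complement. In the latter case [g] sends the complement
   to points farther than [eps / 3] from [p], which then is no cluster point. *)
exists p; have [//|Fn] := in_ultra_setVsetC (ball p eps) UF.
exfalso.
have Fg : (g @ F) (g @` (closure A `&` ~` ball p eps)).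
  by apply: (@filterS _ F _ _ _ _ (filterI FA Fn)) => y yA; exists y.
have [w [[y [Ay ny] <-]]] := pF _ _ Fg (nbhsx_ballx p _ e30).
rewrite -ball_normE /= => pg; apply: ny; rewrite -ball_normE /=.
have -> : eps = eps / 3 + (eps / 3 + eps / 3).
  by field.
rewrite -(subrKA (g y)); apply: (le_lt_trans (ler_normD _ _)); apply: ltrD => //.
by rewrite distrC; case: (gP y).
Qed.

Lemma compact_operator_closed T :
  (forall eps : R, 0 < eps -> exists2 K : bop H, compact_operator K &
     forall x, `|x| <= 1 -> `|T x - K x| <= eps%:C) ->
  compact_operator T.
Proof.
move=> TK; rewrite /compact_operator precompactE; apply: compact_closure => eps eps0.
have epsR : eps = (complex.Re eps)%:C by rewrite RRe_real// gtr0_real.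
have [|K /compact_operatorE[C cC KC] TKe] := TK (complex.Re eps).
  by rewrite -ltcR -epsR.
exists C => // _ [x x1 <-]; exists (K x); first exact: KC.
by rewrite epsR; exact: TKe.
Qed.

End CompactOperators.

(** * Parametrices and the index as a difference of traces *)

Section FredholmIndex.
Context (R : realType) (H : hilbertSpace R).
Implicit Types (S T F G : bop H).

Definition parametrix S T : Prop := finite_rank (1 - S * T) /\ finite_rank (1 - T * S).

Definition pindex S T : R[i] := ftrace (1 - S * T) - ftrace (1 - T * S).

Lemma pindex_int S T : parametrix S T -> exists z : int, pindex S T = z%:~R.
Proof.
move=> [ST TS]; apply: (@trace_defect_int _ _ S T); apply: has_trace_ext (has_ftrace _) => //.
Qed.

Lemma parametrix_diff S S' T : parametrix S T -> parametrix S' T -> finite_rank (S - S').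
Proof.
move=> [ST TS] [S'T TS'].
have -> : S - S' = S * (1 - T * S') - (1 - S * T) * S'.
  by rewrite mulrBr mulrBl mulr1 mul1r mulrA opprB addrA subrK.
by apply: finite_rankB; [exact: finite_rankMl|exact: finite_rankMr].
Qed.

(** The finite-rank operator [D = S - S'] changes the two traces by those of [D T] and [T D], which
    are equal. *)
Lemma pindex_uniq S S' T : parametrix S T -> parametrix S' T -> pindex S T = pindex S' T.
Proof.
move=> pS pS'; have fD := parametrix_diff pS pS'; move: pS' => [S'T TS'].
rewrite /pindex.
have -> : 1 - S * T = (1 - S' * T) - (S - S') * T by rewrite mulrBl opprB addrA subrK.
have -> : 1 - T * S = (1 - T * S') - T * (S - S') by rewrite mulrBr opprB addrA subrK.
have fl := finite_rankMl T fD; have fr := finite_rankMr T fD.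
by rewrite (ftraceB S'T fr) (ftraceB TS' fl) (ftraceMC T fD); ring.
Qed.

Lemma parametrix_perturb S T F : parametrix S T -> finite_rank F ->
  parametrix S (T + F) /\ pindex S (T + F) = pindex S T.
Proof.
move=> [ST TS] fF.
have E1 : 1 - S * (T + F) = (1 - S * T) - S * F by rewrite mulrDr opprD addrA.
have E2 : 1 - (T + F) * S = (1 - T * S) - F * S by rewrite mulrDl opprD addrA.
have fSF := finite_rankMl S fF; have fFS := finite_rankMr S fF.
split; first by split; rewrite ?E1 ?E2; exact: finite_rankB.
by rewrite /pindex E1 E2 (ftraceB ST fSF) (ftraceB TS fFS) (ftraceMC S fF); ring.
Qed.

(** After cyclic rotation, both traces contain the trace of [(1 - T' * S') * (1 - S * T)] with the
    same sign, and it cancels in the difference. *)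
Lemma parametrixM S T S' T' : parametrix S T -> parametrix S' T' ->
  parametrix (S' * S) (T * T') /\ pindex (S' * S) (T * T') = pindex S T + pindex S' T'.
Proof.
move=> [ST TS] [S'T' T'S'].
have E1 : 1 - S' * S * (T * T') = (1 - S' * T') + S' * ((1 - S * T) * T').
  by rewrite mulrBl mul1r mulrBr addrA subrK !mulrA.
have E2 : 1 - T * T' * (S' * S) = (1 - T * S) + T * ((1 - T' * S') * S).
  by rewrite mulrBl mul1r mulrBr addrA subrK !mulrA.
have f1 := finite_rankMr T' ST; have f2 := finite_rankMr S T'S'.
have f3 := finite_rankMl S' f1; have f4 := finite_rankMl T f2.
split; first by split; rewrite ?E1 ?E2; exact: finite_rankD.
rewrite /pindex E1 E2 (ftraceD S'T' f3) (ftraceD TS f4) (ftraceMC _ f1) (ftraceMC _ f2) -!mulrA.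
rewrite -(ftraceMC (T' * S') ST).
have -> : T' * S' * (1 - S * T) = (1 - S * T) - (1 - T' * S') * (1 - S * T).
  by rewrite [(1 - T' * S') * _]mulrBl mul1r opprB [RHS]addrC subrK.
have -> : (1 - T' * S') * (S * T) = (1 - T' * S') - (1 - T' * S') * (1 - S * T).
  by rewrite [(1 - T' * S') * (1 - _)]mulrBr mulr1 opprB [RHS]addrC subrK.
have f5 : finite_rank ((1 - T' * S') * (1 - S * T)) by exact: finite_rankMr.
by rewrite (ftraceB T'S' f5) (ftraceB ST f5); ring.
Qed.

Lemma parametrix_inverse S T : S * T = 1 -> T * S = 1 -> parametrix S T /\ pindex S T = 0.
Proof.
move=> ST TS; rewrite /parametrix /pindex ST TS subrr; split; last by rewrite subrr.
by split; exact: finite_rank0.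
Qed.

Hypotheses (Hsep : separable_space H) (Hinf : infinite_dimensional H).

(** Modulo finite rank, [S * T] and [T * S] are invertible. This yields a left inverse [B * S] and a
    right inverse [S * B'] of [T] modulo finite rank, and such inverses agree modulo finite rank. *)
Lemma compact_parametrix S T : compact_operator (S * T - 1) -> compact_operator (T * S - 1) ->
  exists S', parametrix S' T.
Proof.
move=> /(compact_decomposition Hsep Hinf)[A [B [F [+ fF AB BA]]]].
rewrite addrC subrK => STE.
move=> /(compact_decomposition Hsep Hinf)[A' [B' [F' [+ fF' AB' BA']]]].
rewrite addrC subrK => TSE.
have f1 : finite_rank (1 - B * S * T).
  by rewrite -mulrA STE mulrDr BA opprD addrA subrr add0r; apply/finite_rankN/finite_rankMl.
have f2 : finite_rank (1 - T * (S * B')).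
  by rewrite mulrA TSE mulrDl AB' opprD addrA subrr add0r; apply/finite_rankN/finite_rankMr.
have fD : finite_rank (B * S - S * B').
  have -> : B * S - S * B' = B * S * (1 - T * (S * B')) - (1 - B * S * T) * (S * B').
    by rewrite mulrBr mulrBl mulr1 mul1r !mulrA opprB addrA subrK.
  by apply: finite_rankB; [exact: finite_rankMl|exact: finite_rankMr].
exists (B * S); split=> //.
have -> : 1 - T * (B * S) = 1 - T * (S * B') - T * (B * S - S * B').
  by rewrite mulrBr opprB addrA subrK.
by apply: finite_rankB => //; exact: finite_rankMl.
Qed.

(** With [1 + S * L = A + F], the perturbed operator [T'] equals [T * A] up to finite rank, and the
    invertible [A] has index 0. *)
Lemma pindex_compact S T T' : parametrix S T -> compact_operator (T' - T) ->
  exists2 S', parametrix S' T' & pindex S' T' = pindex S T.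
Proof.
move=> pST cL; pose L := T' - T; have := compact_operatorMl S cL; rewrite -/L.
move=> /(compact_decomposition Hsep Hinf)[A [B [F [E fF AB BA]]]].
have [pBA iBA] := parametrix_inverse BA AB.
have [pm im] := parametrixM pST pBA.
have -> : T' = T * A + ((1 - T * S) * L + T * F).
  have TA : T * A = T + T * S * L - T * F.
    by rewrite -[A](addrK F) -E mulrBr mulrDr mulr1 mulrA.
  rewrite TA [(1 - _) * L]mulrBl mul1r [(L - _) + _]addrC addrA subrK addrACA subrr addr0.
  by rewrite /L addrC subrK.
have fG : finite_rank ((1 - T * S) * L + T * F).
  by apply: finite_rankD; [apply: finite_rankMr; case: pST|exact: finite_rankMl].
have [pp ip] := parametrix_perturb pm fG.
by exists (B * S) => //; rewrite ip im iBA addr0.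
Qed.

(** The index through traces instead of dimensions of kernel and cokernel; integrality and
    additivity then follow from trace identities. *)
Definition calkin_ind (t : calkin H) (z : int) : Prop :=
  exists S T, [/\ to_calkin T = t, parametrix S T & pindex S T = z%:~R].

Lemma calkin_ind_exists (s t : calkin H) : s * t = 1 -> t * s = 1 -> exists z, calkin_ind t z.
Proof.
rewrite -[s]to_calkin_repr -[t]to_calkin_repr; set S := repr s; set T := repr t.
rewrite -!rmorphM -(rmorph1 (@to_calkin _ H)) => /to_calkin_eqP ST /to_calkin_eqP TS.
have [S' pS] := compact_parametrix ST TS; have [z iz] := pindex_int pS.
by exists z, S', T.
Qed.

Lemma calkin_ind_uniq (t : calkin H) y z : calkin_ind t y -> calkin_ind t z -> y = z.
Proof.
move=> [S [T [Tt pT iT]]] [S' [T' [T't pT' iT']]].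
have [|S2 p2 i2] := @pindex_compact S T T' pT.
  by apply/to_calkin_eqP; rewrite Tt T't.
apply/eqP; rewrite -(eqr_int R[i]) -iT -i2 -iT'; apply/eqP; exact: pindex_uniq.
Qed.

Lemma calkin_indM (t t' : calkin H) y z : calkin_ind t y -> calkin_ind t' z ->
  calkin_ind (t * t') (y + z).
Proof.
move=> [S [T [Tt pT iT]]] [S' [T' [T't pT' iT']]].
have [p i] := parametrixM pT pT'; exists (S' * S), (T * T').
by rewrite rmorphM /= Tt T't i iT iT' rmorphD.
Qed.

Lemma calkin_ind_inverse S T : S * T = 1 -> T * S = 1 -> calkin_ind (to_calkin T) 0.
Proof. by move=> ST TS; have [p i] := parametrix_inverse ST TS; exists S, T. Qed.

End FredholmIndex.

(** * The quotient norm *)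

Section CalkinNorm.
Context (R : realType) (H : hilbertSpace R).
Implicit Types (S T U V : bop H) (t : calkin H).

Definition ball_norms T : set R := [set complex.Re `|T x| | x in [set x : H | `|x| <= 1]].

Lemma ball_norms0 T : ball_norms T 0.
Proof. by exists 0; rewrite /= ?normr0// linear0 normr0. Qed.

Lemma norm_Re (x : H) : `|x| = (complex.Re `|x|)%:C.
Proof. by rewrite RRe_real// normr_real. Qed.

Lemma ball_norms_ub T : has_ubound (ball_norms T).
Proof.
have [M M0 TM] := bop_ge0 T; exists (complex.Re M) => _ [x x1 <-].
rewrite -lecR -norm_Re RRe_real ?gtr0_real//; apply: (le_trans (TM x)).
by rewrite ler_piMr// ltW.
Qed.

Lemma opnorm_ge0 T : 0 <= opnorm T.
Proof. exact: ub_le_sup (ball_norms_ub T) _ (ball_norms0 T). Qed.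

Lemma opnorm_ball T x : `|x| <= 1 -> `|T x| <= (opnorm T)%:C.
Proof.
by move=> x1; rewrite norm_Re lecR; apply: ub_le_sup (ball_norms_ub T) _ _; exists x.
Qed.

Lemma opnorm0 : opnorm (0 : bop H) = 0.
Proof.
apply/eqP; rewrite eq_le opnorm_ge0 andbT; apply: ge_sup.
  by exists 0; exact: ball_norms0.
by move=> _ [x _ <-]; rewrite normr0.
Qed.

Lemma lift_norms_lb t : lbound [set opnorm T | T in [set T | to_calkin T = t]] 0.
Proof. by move=> _ [T _ <-]; exact: opnorm_ge0. Qed.

Lemma calkin_norm0 : calkin_norm (0 : calkin H) = 0.
Proof.
apply/eqP; rewrite eq_le; apply/andP; split.
  apply: ge_inf; first by exists 0; exact: lift_norms_lb.
  by exists 0; rewrite /= ?raddf0// opnorm0.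
apply: lb_le_inf; last exact: lift_norms_lb.
by exists (opnorm (0 : bop H)), 0 => //=; exact: raddf0.
Qed.

(** Subtracting lifts of small norm from [repr t] exhibits it as a norm limit of compact
    operators. *)
Lemma calkin_norm_le0 t : calkin_norm t <= 0 -> t = 0.
Proof.
move=> t0; rewrite -[t]to_calkin_repr -(raddf0 (@to_calkin _ H)).
apply/to_calkin_eqP; rewrite subr0; apply: compact_operator_closed => eps eps0.
have [||_ [T /= Tt <-] Teps] := @inf_adherent R [set opnorm T | T in [set T | to_calkin T = t]] eps.
- exact: eps0.
- split; last by exists 0; exact: lift_norms_lb.
  by exists (opnorm (repr t)), (repr t) => //=; rewrite to_calkin_repr.
exists (repr t - T); first by apply/to_calkin_eqP; rewrite to_calkin_repr.
move=> x x1; rewrite bopBE opprB addrC subrK; apply: (le_trans (opnorm_ball T x1)).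
rewrite lecR; apply: ltW; apply: (lt_le_trans Teps).
by rewrite -[leRHS]add0r lerD2r.
Qed.

Lemma opnorm_unitary U V T : (forall x, `|U x| = `|x|) -> (forall x, `|V x| = `|x|) ->
  V * U = 1 -> opnorm (U * T * V) = opnorm T.
Proof.
move=> UN VN VU; congr (sup _); apply/seteqP; split=> [_ [x x1 <-]|_ [x x1 <-]].
  by exists (V x); rewrite /= ?VN// UN.
by exists (U x); rewrite /= ?UN// -(bopME V) VU.
Qed.

(** Conjugation by [U] is a norm-preserving bijection between the lifts of the two classes. *)
Lemma calkin_norm_unitary U V t : (forall x, `|U x| = `|x|) -> (forall x, `|V x| = `|x|) ->
  U * V = 1 -> V * U = 1 ->
  calkin_norm (to_calkin U * t * to_calkin V) = calkin_norm t.
Proof.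
move=> UN VN UV VU; congr (inf _); apply/seteqP; split=> [_ [T TE <-]|_ [T TE <-]].
  have vu : to_calkin V * to_calkin U = 1 by rewrite -rmorphM /= VU rmorph1.
  exists (V * T * U); last by rewrite opnorm_unitary.
  by rewrite /= !rmorphM /= [to_calkin T]TE !mulrA vu mul1r -mulrA vu mulr1.
by exists (U * T * V); [rewrite /= !rmorphM /= [to_calkin T]TE|rewrite opnorm_unitary].
Qed.

End CalkinNorm.

(** * Divisibility of the index *)

Section Corners.
Context (Q : pzRingType).
Implicit Types (e s t x z : Q).

(** For an idempotent [e] commuting with [t], the compression of [t] to [e], completed by the
    identity on the complement so that invertibility can be stated in [Q] itself. *)
Definition corner e t : Q := e * t + (1 - e).

Lemma corner1 e : corner e 1 = 1.
Proof. by rewrite /corner mulr1 addrC subrK. Qed.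

Lemma complK e : 1 - (1 - e) = e.
Proof. by rewrite opprB addrC subrK. Qed.

Lemma idem_compl e : e * e = e -> (1 - e) * (1 - e) = 1 - e.
Proof. by move=> ee; rewrite mulrBl mul1r mulrBr mulr1 ee subrr subr0. Qed.

Lemma cornerM e s t : e * e = e -> GRing.comm e s -> corner e s * corner e t = corner e (s * t).
Proof.
move=> ee es; rewrite /corner mulrDl (mulrDr (e * s)) (mulrDr (1 - e)) idem_compl//.
have -> : e * s * (e * t) = e * (s * t) by rewrite mulrA es -[s * e * e]mulrA ee -es mulrA.
have ese : e * s * e = e * s by rewrite es -mulrA ee.
have -> : e * s * (1 - e) = 0 by rewrite mulrBr mulr1 ese subrr.
have -> : (1 - e) * (e * t) = 0 by rewrite mulrBl mul1r mulrA ee subrr.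
by rewrite addr0 add0r.
Qed.

Lemma corner_compl e t : e * e = e -> GRing.comm e t -> corner e t * corner (1 - e) t = t.
Proof.
move=> ee et; rewrite /corner complK.
have e0 : e * (1 - e) = 0 by rewrite mulrBr mulr1 ee subrr.
have e0' : (1 - e) * e = 0 by rewrite mulrBl mul1r ee subrr.
rewrite mulrDl !mulrDr -[e * t * (_ * t)]mulrA.
have -> : t * ((1 - e) * t) = (1 - e) * t * t.
  by rewrite mulrA mulrBr mulr1 -et [(1 - e) * t]mulrBl mul1r.
rewrite !mulrA e0 !mul0r add0r idem_compl// e0' addr0.
by rewrite -mulrA -et mulrA ee -mulrDl addrC subrK mul1r.
Qed.

Lemma comm_inverse s t x : s * t = 1 -> t * s = 1 -> GRing.comm x t -> GRing.comm x s.
Proof.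
move=> st ts xt; rewrite /GRing.comm -[x * s]mul1r -st -mulrA [t * _]mulrA -xt.
by rewrite -mulrA ts mulr1.
Qed.

Lemma mul_sandwich s s' t t' : s' * s = 1 -> t' * t = 1 -> s' * t' * s' * (s * t * s) = 1.
Proof.
by move=> ss tt; rewrite !mulrA -(mulrA (s' * t')) ss mulr1 -(mulrA s') tt mulr1 ss.
Qed.

Lemma comm_corner e t x : GRing.comm x e -> GRing.comm x t -> GRing.comm x (corner e t).
Proof.
move=> xe xt; apply: commrD; first exact: commrM.
by apply: commrB => //; exact: commr1.
Qed.

Variable ind : Q -> int -> Prop.
Hypothesis ind_exists : forall s t, s * t = 1 -> t * s = 1 -> exists k, ind t k.
Hypothesis ind_uniq : forall t k l, ind t k -> ind t l -> k = l.
Hypothesis indM : forall s t k l, ind s k -> ind t l -> ind (s * t) (k + l).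

(** The involution [x] exchanges [e] and [1 - e], so it conjugates [corner e t] to
    [corner (1 - e) t]; the product of the two is [t]. *)
Lemma ind_halving x e s t k : x * x = 1 -> ind x 0 -> e * e = e -> x * e = (1 - e) * x ->
  s * t = 1 -> t * s = 1 -> GRing.comm e t -> GRing.comm x t -> ind t k ->
  exists2 l, ind (corner e t) l & k = l + l.
Proof.
move=> xx x0 ee xe st ts et xt tk.
have es : GRing.comm e s by exact: comm_inverse st ts et.
have [l tl] : exists l, ind (corner e t) l.
  by apply: (@ind_exists (corner e s)); rewrite cornerM// ?st ?ts corner1.
exists l => //; apply: (ind_uniq tk).
rewrite -(corner_compl ee et); apply: indM => //.
have -> : corner (1 - e) t = x * corner e t * x.
  have A : x * (e * t) * x = (1 - e) * t.
    by rewrite mulrA xe -[_ * x * t]mulrA xt mulrA -[_ * x * x]mulrA xx mulr1.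
  have B : x * (1 - e) * x = e.
    rewrite mulrBr mulr1 xe [(1 - e) * x]mulrBl mul1r opprB addrC subrK.
    by rewrite -mulrA xx mulr1.
  by rewrite /corner complK mulrDr mulrDl A B.
by rewrite -[l]addr0 -[l in l + _]add0r; apply: indM => //; exact: indM.
Qed.

Variable half : Q.
Hypothesis half_double : half + half = 1.
Hypothesis half_comm : forall t, GRing.comm t half.

(** The projection to the eigenvalue 1 of an involution [z]. The central element [half] stands in
    for the scalar one half, as [Q] is only a ring. *)
Definition spectral z : Q := half * (1 + z).

Lemma spectral_idem z : z * z = 1 -> spectral z * spectral z = spectral z.
Proof.
move=> zz; have E : (1 + z) * (1 + z) = (1 + z) + (1 + z).
  by rewrite mulrDl mul1r mulrDr mulr1 zz [z + 1]addrC.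
rewrite /spectral -mulrA [(1 + z) * _]mulrA (half_comm (1 + z)) -mulrA E.
by rewrite (mulrDr half (1 + z)) -mulrDl half_double mul1r.
Qed.

Lemma spectral_compl z : 1 - spectral z = half * (1 - z).
Proof.
rewrite /spectral mulrDr mulrBr mulr1 -{1}half_double opprD addrA.
by rewrite addrK.
Qed.

Lemma spectral_anticomm x z : x * z = - (z * x) ->
  x * spectral z = (1 - spectral z) * x.
Proof.
move=> xz; rewrite spectral_compl /spectral mulrA (half_comm x) -!mulrA; congr (_ * _).
by rewrite mulrDr mulrBl mulr1 mul1r xz.
Qed.

Lemma comm_spectral x z : GRing.comm x z -> GRing.comm x (spectral z).
Proof.
move=> xz; apply: commrM; first exact: half_comm.
by apply: commrD => //; exact: commr1.
Qed.

Lemma ind_divisible n (x z : nat -> Q) s t k :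
  (forall i, (i < n)%N ->
     [/\ x i * x i = 1, z i * z i = 1, x i * z i = - (z i * x i) & ind (x i) 0]) ->
  (forall i j, (i < n)%N -> (j < n)%N -> i != j ->
     GRing.comm (x i) (z j) /\ GRing.comm (z i) (z j)) ->
  (forall i, (i < n)%N -> GRing.comm (x i) t /\ GRing.comm (z i) t) ->
  s * t = 1 -> t * s = 1 -> ind t k -> exists q : int, k = q * 2 ^+ n.
Proof.
elim: n => [|n IHn] in s t k * => rel cc ct st ts tk.
  by exists k; rewrite expr0 mulr1.
have [xx zz xz x0] := rel n (leqnn _); have [xt zt] := ct n (leqnn _).
have ee := spectral_idem zz.
have et : GRing.comm (spectral (z n)) t by apply/commr_sym/comm_spectral/commr_sym.
have es := comm_inverse st ts et.
(* The last pair is used up to halve the index. The remaining pairs commute with its spectral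
   projection, hence with the corner to which the induction applies. *)
have [l tl ->] := ind_halving xx x0 ee (spectral_anticomm xz) st ts et xt tk.
have [||||||q ->] := IHn (corner (spectral (z n)) s) (corner (spectral (z n)) t) l.
- by move=> i /ltnW; exact: rel.
- by move=> i j /ltnW ni /ltnW nj; exact: cc.
- move=> i ni; have [xi zi] := cc i n (ltnW ni) (leqnn _) (negbT (ltn_eqF ni)).
  have [xit zit] := ct i (ltnW ni).
  by split; apply: comm_corner => //; exact: comm_spectral.
- by rewrite cornerM// st corner1.
- by rewrite cornerM// ts corner1.
- exact: tl.
by exists q; rewrite -mulrDr exprS mulr_natl mulr2n.
Qed.

End Corners.

(** * Types and conjugation *)

Section Types.
Context (R : realType) (G : groupType) (d : G -> G -> R).
Implicit Types (a b : nat -> G) (phi : formula R) (g : G).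

Lemma word_eval_support w : exists N, forall a b,
  (forall n, (n < N)%N -> a n = b n) -> word_eval w a = word_eval w b.
Proof.
elim: w => [n||s [N sN] t [M tM]|s [N sN]].
- by exists n.+1 => a b; apply.
- by exists 0%N.
- exists (maxn N M) => a b ab /=; congr (_ * _)%g; [apply: sN|apply: tM] => n nN; apply: ab.
    by rewrite leq_max nN.
  by rewrite leq_max nN orbT.
- by exists N => a b ab /=; congr (_^-1)%g; exact: sN.
Qed.

Lemma update_support N a b x g : (forall n, (n < N)%N -> a n = b n) ->
  forall n, (n < N)%N -> update a x g n = update b x g n.
Proof. by move=> ab n nN; rewrite /update; case: eqP => // _; exact: ab. Qed.

Lemma interp_support phi : exists N, forall a b,
  (forall n, (n < N)%N -> a n = b n) -> interp d phi a = interp d phi b.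
Proof.
elim: phi => [s t|n f psi /choice[N NP]|x phi [N NP]|x phi [N NP]].
- have [[N sN] [M tM]] := (word_eval_support s, word_eval_support t).
  exists (maxn N M) => a b ab /=; congr d; [apply: sN|apply: tM] => n nN; apply: ab.
    by rewrite leq_max nN.
  by rewrite leq_max nN orbT.
- exists (\max_i N i) => a b ab /=; congr (f _); apply/rowP => i; rewrite !mxE.
  by apply: NP => m mN; apply: ab; apply: leq_trans mN _; exact: leq_bigmax.
- exists N => a b ab /=; congr (sup _); apply/seteqP; split=> _ [g _ <-]; exists g => //;
    by apply: NP => n; apply: update_support => k kN; rewrite ab.
- exists N => a b ab /=; congr (inf _); apply/seteqP; split=> _ [g _ <-]; exists g => //;
    by apply: NP => n; apply: update_support => k kN; rewrite ab.
Qed.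

Definition conj_seq g a : nat -> G := fun n => (g * a n * g^-1)%g.

Lemma word_eval_conj g w a : word_eval w (conj_seq g a) = (g * word_eval w a * g^-1)%g.
Proof.
elim: w => [n||s IHs t IHt|s IHs] //=.
- by rewrite mulg1 mulgV.
- by rewrite IHs IHt !mulgA mulgVK.
- by rewrite IHs !invgM invgK mulgA.
Qed.

Lemma update_conj g a x h : update (conj_seq g a) x (g * h * g^-1)%g = conj_seq g (update a x h).
Proof. by apply/funext => n; rewrite /update /conj_seq; case: eqP. Qed.

Lemma range_conj (T : Type) (f f' : G -> T) g : (forall h, f' (g * h * g^-1)%g = f h) ->
  range f' = range f.
Proof.
move=> ff'; apply/seteqP; split=> _ [h _ <-]; last by exists (g * h * g^-1)%g.
by exists (g^-1 * h * g)%g => //; rewrite -ff' !mulgA mulgV mul1g mulgK.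
Qed.

Definition isometric_conj g : Prop :=
  forall u v, d (g * u * g^-1)%g (g * v * g^-1)%g = d u v.

Lemma isometric_conj1 : isometric_conj 1%g.
Proof. by move=> u v; rewrite invg1 !mul1g !mulg1. Qed.

Lemma isometric_conjM g h : isometric_conj g -> isometric_conj h -> isometric_conj (g * h)%g.
Proof.
move=> gi hi u v; rewrite -[RHS]hi -[RHS]gi.
by congr d; rewrite invgM !mulgA.
Qed.

(** Under a quantifier the bound variable is reindexed by conjugation, a bijection of the group, so
    the set of values is unchanged. *)
Lemma interp_conj g phi a : isometric_conj g -> interp d phi (conj_seq g a) = interp d phi a.
Proof.
move=> gi; elim: phi a => [s t|n f psi IH|x phi IH|x phi IH] a /=.
- by rewrite !word_eval_conj gi.
- by congr (f _); apply/rowP => i; rewrite !mxE.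
- by congr (sup _); apply: (range_conj (g := g)) => h; rewrite update_conj IH.
- by congr (inf _); apply: (range_conj (g := g)) => h; rewrite update_conj IH.
Qed.

Lemma type_of_locally_conj a b :
  (forall N, exists2 g, isometric_conj g & forall n, (n < N)%N -> b n = (g * a n * g^-1)%g) ->
  type_of d a = type_of d b.
Proof.
move=> ab; apply/seteqP; suff E phi : interp d phi a = interp d phi b.
  by split=> -[phi r] [] r0 pr; split=> //=; rewrite /= ?E// -E.
have [N NP] := interp_support phi; have [g gi gb] := ab N.
by rewrite -(interp_conj _ _ gi); apply: NP => n nN; rewrite gb.
Qed.

Lemma type_of_word_eq a b s t : type_of d a = type_of d b ->
  d (word_eval s a) (word_eval t a) <= 0 -> d (word_eval s b) (word_eval t b) <= 0.
Proof.
move=> ab st; have : type_of d a (FDist R s t, 0) by split.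
by rewrite ab => -[].
Qed.

End Types.

(** * The model *)

Section BinaryDigits.

Definition flip (s i : nat) : nat := Nat.lxor s (Nat.pow 2 i).

Lemma testbit_flip s i j : Nat.testbit (flip s i) j = Nat.testbit s j (+) (i == j).
Proof.
rewrite /flip PeanoNat.Nat.lxor_spec PeanoNat.Nat.pow2_bits_eqb.
have -> : PeanoNat.Nat.eqb i j = (i == j).
  by apply/idP/eqP => [/PeanoNat.Nat.eqb_eq//|->]; rewrite PeanoNat.Nat.eqb_refl.
by case: (Nat.testbit s j); case: (i == j).
Qed.

Lemma flipK i : involutive (flip^~ i).
Proof.
move=> s; rewrite /flip PeanoNat.Nat.lxor_assoc PeanoNat.Nat.lxor_nilpotent.
exact: PeanoNat.Nat.lxor_0_r.
Qed.

(** The bound [s < 2 ^ m] in a form that is visibly invariant under flips of digits below [m]. *)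
Definition low m s : bool := Nat.shiftr s m == 0.

Lemma low_flip m s i : (i < m)%N -> low m (flip s i) = low m s.
Proof.
move=> im; rewrite /low /flip PeanoNat.Nat.shiftr_lxor.
suff -> : Nat.shiftr (Nat.pow 2 i) m = 0%N by rewrite PeanoNat.Nat.lxor_0_r.
rewrite PeanoNat.Nat.shiftr_div_pow2 PeanoNat.Nat.div_small//.
by apply: PeanoNat.Nat.pow_lt_mono_r; lia.
Qed.

Lemma low_lt m s : low m s = (s < 2 ^ m)%N.
Proof.
have -> : (2 ^ m = Nat.pow 2 m)%N.
  by elim: m => [//|m IHm]; rewrite expnS IHm /=; lia.
rewrite /low PeanoNat.Nat.shiftr_div_pow2.
have p0 : Nat.pow 2 m <> 0%N by exact: PeanoNat.Nat.pow_nonzero.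
have E := PeanoNat.Nat.div_small_iff s _ p0.
by apply/eqP/idP => [/E.1 ?|?]; [apply/ssrnat.ltP|apply/E.2/ssrnat.ltP].
Qed.

End BinaryDigits.

Section Model.
Context (R : realType) (H : hilbertSpace R).
Variable f : nat -> H.
Hypothesis fb : orthonormal_basis f.
Variables (code : int * nat -> nat) (decode : nat -> int * nat).
Hypotheses (codeK : cancel code decode) (decodeK : cancel decode code).

Definition vec (i : int * nat) : H := f (code i).

Lemma hdot_vec i j : hdot H (vec i) (vec j) = (i == j)%:R.
Proof. by rewrite fb.1 (can_eq codeK). Qed.

Lemma bopNE (T : bop H) x : (- T) x = - T x. Proof. by []. Qed.

Lemma bop_eq_vec (S T : bop H) : (forall i, S (vec i) = T (vec i)) -> S = T.
Proof.
by move=> ST; apply: (bop_eq_basis fb) => n; have := ST (decode n); rewrite /vec decodeK.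
Qed.

(** A signed permutation of the basis. For injective [psi] such an operator exists and the default 0
    is not taken; relations between these operators reduce to index computations. *)
Definition sperm (th : int * nat -> bool) (psi : int * nat -> int * nat) : bop H :=
  xget 0 [set U : bop H | (forall x, `|U x| = `|x|) /\
                          forall i, U (vec i) = (-1) ^+ th i *: vec (psi i)].

Lemma spermP th psi : injective psi ->
  (forall x, `|sperm th psi x| = `|x|) /\
  forall i, sperm th psi (vec i) = (-1) ^+ th i *: vec (psi i).
Proof.
move=> ipsi; pose g n : H := (-1) ^+ th (decode n) *: vec (psi (decode n)).
have og : orthonormal g.
  move=> m n; rewrite linearZl_LR /= linearZr_LR /= hdot_vec (inj_eq ipsi) (can_eq decodeK).
  have [->|_] := eqVneq m n; last by rewrite !mulr0.
  by rewrite mulr1 conj_Creal ?rpredX ?rpredN ?rpred1// -expr2 sqrr_sign.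
have [U [UN UE]] := basis_isometry fb og.
apply: (xgetPex 0 (P := [set U : bop H | (forall x, `|U x| = `|x|) /\
  forall i, U (vec i) = (-1) ^+ th i *: vec (psi i)])).
by exists U; split=> // i; rewrite /vec UE /g codeK.
Qed.

Lemma sperm_norm th psi x : injective psi -> `|sperm th psi x| = `|x|.
Proof. by move=> /(spermP th)[]. Qed.

Lemma spermE th psi i : injective psi -> sperm th psi (vec i) = (-1) ^+ th i *: vec (psi i).
Proof. by move=> /(spermP th)[]. Qed.

Lemma spermM th psi th' psi' : injective psi -> injective psi' ->
  sperm th psi * sperm th' psi' = sperm (fun i => th' i (+) th (psi' i)) (psi \o psi').
Proof.
move=> i1 i2; apply: bop_eq_vec => i; rewrite bopME spermE// linearZ /= spermE// scalerA.
by rewrite -signr_addb spermE//; exact: inj_comp.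
Qed.

Lemma sperm1 th psi : (forall i, th i = false) -> (forall i, psi i = i) -> sperm th psi = 1.
Proof.
move=> th0 psi1; apply: bop_eq_vec => i; rewrite bop1E spermE ?th0 ?psi1 ?scale1r//.
by move=> j k; rewrite !psi1.
Qed.

Lemma eq_sperm th psi th' psi' : th =1 th' -> psi =1 psi' -> sperm th psi = sperm th' psi'.
Proof. by move=> /funext -> /funext ->. Qed.

Definition no_sign (i : int * nat) : bool := false.
Definition reflect_idx (i : int * nat) : int * nat := (- 1 - i.1, i.2).
Definition flip_idx n (i : int * nat) : int * nat := (i.1, flip i.2 n).
Definition shift_idx j (i : int * nat) : int * nat :=
  if low (2 * j) i.2 then (i.1 + 1, i.2) else i.
Definition unshift_idx j (i : int * nat) : int * nat :=
  if low (2 * j) i.2 then (i.1 - 1, i.2) else i.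

Lemma reflect_idxK : involutive reflect_idx.
Proof. by move=> [k s]; rewrite /reflect_idx /=; congr pair; lia. Qed.
Lemma flip_idxK n : involutive (flip_idx n).
Proof. by move=> [k s]; rewrite /flip_idx /= flipK. Qed.
Lemma shift_idxK j : cancel (shift_idx j) (unshift_idx j).
Proof.
move=> [k s]; rewrite /unshift_idx /shift_idx /=.
by case E: (low _ s); rewrite /= E ?addrK.
Qed.
Lemma unshift_idxK j : cancel (unshift_idx j) (shift_idx j).
Proof.
move=> [k s]; rewrite /unshift_idx /shift_idx /=.
by case E: (low _ s); rewrite /= E ?subrK.
Qed.

Let inj_id : injective (@id (int * nat)) := @inj_id _.
Let inj_r := inv_inj reflect_idxK.
Let inj_f n := inv_inj (flip_idxK n).
Let inj_s j := can_inj (shift_idxK j).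
Let inj_u j := can_inj (unshift_idxK j).

Definition opX : bop H := sperm (fun i => i.1 < 0) id.
Definition opZ n : bop H := sperm (fun i => Nat.testbit i.2 n) id.
Definition opF n : bop H := sperm no_sign (flip_idx n).
Definition opJ : bop H := sperm no_sign reflect_idx.
Definition opW j : bop H := sperm no_sign (shift_idx j).
Definition opW' j : bop H := sperm no_sign (unshift_idx j).

Lemma opXX : opX * opX = 1.
Proof. by rewrite spermM//; apply: sperm1 => i //=; rewrite addbb. Qed.
Lemma opZZ n : opZ n * opZ n = 1.
Proof. by rewrite spermM//; apply: sperm1 => i //=; rewrite addbb. Qed.
Lemma opFF n : opF n * opF n = 1.
Proof. by rewrite spermM//; apply: sperm1 => i //=; rewrite flip_idxK. Qed.
Lemma opWW' j : opW j * opW' j = 1.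
Proof. by rewrite spermM//; apply: sperm1 => i //=; rewrite unshift_idxK. Qed.
Lemma opXZ n : opX * opZ n = opZ n * opX.
Proof. by rewrite !spermM//; apply: eq_sperm => i //=; rewrite addbC. Qed.
Lemma opXF n : opX * opF n = opF n * opX.
Proof. by rewrite !spermM//; apply: eq_sperm => i //=; rewrite addbF. Qed.
Lemma opZZC m n : opZ m * opZ n = opZ n * opZ m.
Proof. by rewrite !spermM//; apply: eq_sperm => i //=; rewrite addbC. Qed.
Lemma opFZC m n : m != n -> opF m * opZ n = opZ n * opF m.
Proof.
move=> mn; rewrite !spermM//; apply: eq_sperm => i //=.
by rewrite testbit_flip (negPf mn) !addbF.
Qed.
Lemma opFZ n : opF n * opZ n = - (opZ n * opF n).
Proof.
apply: bop_eq_vec => i; rewrite bopNE !bopME.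
rewrite !spermE// !linearZ /= !spermE// /= testbit_flip eqxx addbT signrN scale1r !scaleNr.
by rewrite expr0 scale1r opprK.
Qed.

Lemma opJX : opJ * opX = - (opX * opJ).
Proof.
apply: bop_eq_vec => i; rewrite bopNE !bopME.
rewrite !spermE// !linearZ /= !spermE// /= !scale1r -scaleNr -signrN.
by congr (_ ^+ _ *: _); lia.
Qed.
Lemma opJZ n : opJ * opZ n = opZ n * opJ.
Proof. by rewrite !spermM//; apply: eq_sperm => i //=; rewrite addbF. Qed.
Lemma opJF n : opJ * opF n = opF n * opJ.
Proof. by rewrite !spermM//; apply: eq_sperm. Qed.
Lemma opWJ j : opW j * opJ = opJ * opW' j.
Proof.
rewrite !spermM//; apply: eq_sperm => -[k s] //=.
by rewrite /shift_idx /unshift_idx /reflect_idx /=; case: ifP => //= _; congr pair; lia.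
Qed.
Lemma opWWC i j : opW i * opW j = opW j * opW i.
Proof.
rewrite !spermM//; apply: eq_sperm => -[k s] //=; rewrite /shift_idx /=.
by case Ei: (low (2 * i) s); case Ej: (low (2 * j) s); rewrite /= ?Ei ?Ej /= ?Ei ?Ej.
Qed.
Lemma opWZ j n : opW j * opZ n = opZ n * opW j.
Proof.
rewrite !spermM//; apply: eq_sperm => -[k s] //=.
by rewrite addbF /shift_idx /=; case: ifP.
Qed.
Lemma opWF j n : (n < 2 * j)%N -> opW j * opF n = opF n * opW j.
Proof.
move=> nj; rewrite !spermM//; apply: eq_sperm => -[k s] //=.
by rewrite /shift_idx /flip_idx /= low_flip//; case: ifP.
Qed.

Lemma sum_rank1_vec m (k0 : int) (g : nat -> H) k t :
  (\sum_(s < m) rank1 (vec (k0, s : nat)) (g s)) (vec (k, t)) =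
  if (k == k0) && (t < m)%N then g t else 0.
Proof.
rewrite bop_sumE; case: ifP => [/andP[/eqP -> tm]|kt].
  rewrite (bigD1 (Ordinal tm))//= hdot_vec eqxx scale1r big1 ?addr0// => s st.
  rewrite /= hdot_vec xpair_eqE eqxx /= eq_sym -[t]/(nat_of_ord (Ordinal tm)) val_eqE (negPf st).
  by rewrite scale0r.
rewrite big1// => s _ /=; rewrite hdot_vec xpair_eqE.
case: eqP kt => [_ /= ts|_ _]; last by rewrite scale0r.
by case: eqP => [E|_]; rewrite ?scale0r//; move: ts; rewrite E ltn_ord.
Qed.

Lemma compact_sum (I : Type) (r : seq I) (T : I -> bop H) :
  (forall i, compact_operator (T i)) -> compact_operator (\sum_(i <- r) T i).
Proof.
move=> cT; apply/compact_operatorP; apply: rpred_sum => i _; exact/compact_operatorP.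
Qed.

(** The shift changes the sign of [k] only from [-1] to [0], and it moves only finitely many [s], so
    the commutator has finite rank. *)
Lemma opXW j : to_calkin (opX * opW j) = to_calkin (opW j * opX).
Proof.
apply/to_calkin_eqP.
have -> : opX * opW j - opW j * opX =
    \sum_(s < 2 ^ (2 * j)) rank1 (vec (-1, s : nat)) (vec (0, s : nat) *+ 2).
  apply: bop_eq_vec => -[k s]; rewrite (sum_rank1_vec _ _ (fun s => vec (0, s) *+ 2)).
  rewrite bopBE !bopME !spermE// !linearZ /= !spermE// /= !scale1r scalerN /shift_idx /= low_lt.
  case: ifP => /= sj; last by rewrite andbF subrr.
  rewrite andbT -scalerBl; case: eqP => [->|k1].
    by rewrite addNr ltxx ltrN10 expr0 expr1 opprK scalerDl scale1r mulr2n.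
  have -> : (k + 1 < 0) = (k < 0) by lia.
  by rewrite subrr scale0r.
by apply: compact_sum => s; exact: rank1_compact.
Qed.

Lemma half_op_bounded : (fun x : H => 2^-1 *: x) \in @bounded_linear_pred R H.
Proof.
apply/bounded_linearP; split=> [a x y|].
  by rewrite scalerDr !scalerA mulrC.
by exists `|2^-1| => x; rewrite normrZ.
Qed.

Definition half_op : bop H := Bop half_op_bounded.

Lemma half_sum : 2^-1 + 2^-1 = 1 :> R[i].
Proof. by rewrite [RHS](splitr 1) mul1r. Qed.

Lemma half_op_double : half_op + half_op = 1.
Proof.
apply: bop_eqP => x; rewrite bopDE bop1E /= -scalerDl.
by rewrite half_sum scale1r.
Qed.

Lemma half_op_comm (T : bop H) : T * half_op = half_op * T.
Proof. by apply: bop_eqP => x; rewrite !bopME /= linearZ. Qed.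

Lemma calkin_half_comm (t : calkin H) : GRing.comm t (to_calkin half_op).
Proof.
rewrite -[t]to_calkin_repr /GRing.comm -!rmorphM /=; congr to_calkin; exact: half_op_comm.
Qed.

Definition opP : bop H := spectral half_op opX.

Lemma calkin_opP : to_calkin opP = spectral (to_calkin half_op) (to_calkin opX).
Proof. by rewrite /opP /spectral rmorphM rmorphD rmorph1. Qed.

Lemma opP_vec k s : opP (vec (k, s)) = if 0 <= k then vec (k, s) else 0.
Proof.
rewrite bopME bopDE bop1E /= spermE//= ltNge; case: ifP => _ /=.
  by rewrite scale1r scalerDr -scalerDl half_sum scale1r.
by rewrite expr1 scaleN1r subrr scaler0.
Qed.

Lemma compl_opP_vec k s : (1 - opP) (vec (k, s)) = if 0 <= k then 0 else vec (k, s).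
Proof. by rewrite bopBE bop1E opP_vec; case: ifP => _; rewrite ?subrr ?subr0. Qed.

Lemma shift_idxE j k s :
  shift_idx j (k, s) = if (s < 2 ^ (2 * j))%N then (k + 1, s) else (k, s).
Proof. by rewrite /shift_idx low_lt. Qed.

Lemma unshift_idxE j k s :
  unshift_idx j (k, s) = if (s < 2 ^ (2 * j))%N then (k - 1, s) else (k, s).
Proof. by rewrite /unshift_idx low_lt. Qed.

(** On [k >= 0] the corner is a unilateral shift on [4 ^ j] coordinates: it has a left inverse, and
    the vectors [vec (0, s)] with [s < 4 ^ j] span the complement of its range. *)
Lemma corner_opW_ind j :
  calkin_ind (corner (to_calkin opP) (to_calkin (opW j))) (- (4 ^ j)%:Z).
Proof.
pose V := opW j * opP + (1 - opP); pose V' := opP * opW' j + (1 - opP).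
have VE k s : V (vec (k, s)) = if 0 <= k then vec (shift_idx j (k, s)) else vec (k, s).
  rewrite bopDE bopME compl_opP_vec opP_vec; case: ifP => _.
    by rewrite spermE// scale1r addr0.
  by rewrite linear0 add0r.
have V'E k s : V' (vec (k, s)) = if 0 <= k then
    (if (k == 0) && (s < 2 ^ (2 * j))%N then 0 else vec (unshift_idx j (k, s))) else vec (k, s).
  rewrite bopDE bopME compl_opP_vec spermE// scale1r unshift_idxE.
  case: (s < _)%N; rewrite opP_vec ?andbT ?andbF; last by case: ifP; rewrite ?addr0 ?add0r.
  have [->|k0] := eqVneq k 0; first by rewrite /= addr0.
  have -> : (0 <= k - 1) = (0 <= k) by lia.
  by case: ifP; rewrite ?addr0 ?add0r.
have V'V : V' * V = 1.
  apply: bop_eq_vec => -[k s]; rewrite bopME bop1E VE; case: ifP => k0; last by rewrite V'E k0.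
  rewrite shift_idxE; case: ifP => sj.
    rewrite V'E sj andbT; have -> : (0 <= k + 1) by lia.
    have -> : (k + 1 == 0) = false by lia.
    by rewrite unshift_idxE sj addrK.
  by rewrite V'E sj andbF k0 unshift_idxE sj.
have VV' : 1 - V * V' = \sum_(s < 2 ^ (2 * j)) rank1 (vec (0, s : nat)) (vec (0, s : nat)).
  apply: bop_eq_vec => -[k s]; rewrite (sum_rank1_vec _ _ (fun s => vec (0, s))).
  rewrite bopBE bopME bop1E V'E; case: ifP => k0; last first.
    have -> : (k == 0) = false by apply/negP => /eqP E; rewrite E in k0.
    by rewrite VE k0 subrr.
  case: ifP => [/andP[/eqP -> _]|ks]; first by rewrite linear0 subr0.
  rewrite unshift_idxE; move: ks; case: ifP => sj ks.
    have k1 : 0 <= k - 1 by move: ks; rewrite andbT => /negbT; lia.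
    by rewrite VE k1 shift_idxE sj subrK subrr.
  by rewrite VE k0 shift_idxE sj subrr.
have fVV' : finite_rank (1 - V * V').
  by rewrite VV'; apply: finite_rank_sum => s; exact: finite_rank_rank1.
exists V', V; split.
(* The projection is on the right in [V], which gives an exact left inverse, but on the left in
   [corner]; the two agree modulo compact operators. *)
- have -> : to_calkin V = to_calkin (opW j) * to_calkin opP + (1 - to_calkin opP).
    by rewrite rmorphD rmorphB rmorph1 rmorphM.
  rewrite /corner; congr (_ + _).
  rewrite calkin_opP; apply: comm_spectral; last by rewrite /GRing.comm -!rmorphM /= opXW.
  exact: calkin_half_comm.
- by split=> //; rewrite V'V subrr; exact: finite_rank0.
- rewrite /pindex V'V subrr ftrace0 VV' sub0r ftrace_sum => [|s]; last exact: finite_rank_rank1.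
  rewrite (eq_bigr (fun=> 1)) => [|s _]; last first.
    by rewrite (ftrace_eq (has_trace_rank1 _ _)) hdot_vec eqxx.
  by rewrite sumr_const card_ord expnM rmorphN.
Qed.

End Model.

(** * Non-homogeneity *)

Section UnitaryClasses.
Context (R : realType) (H : hilbertSpace R).
Implicit Types (U V T : bop H) (u v : calkin_U0 H).

Definition unitary_op U : Prop :=
  (forall x, `|U x| = `|x|) /\ exists V, U * V = 1 /\ V * U = 1.

Lemma unitary_op_inv U V : unitary_op U -> U * V = 1 -> forall x, `|V x| = `|x|.
Proof. by move=> [UN _] UV x; rewrite -UN -(bopME U) UV. Qed.

Lemma unitary_op_U0 U : unitary_op U -> to_calkin U \in @U0_pred R H.
Proof.
move=> [UN [V [UV VU]]]; apply/U0P; split.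
  exists (to_calkin V); rewrite -!rmorphM /= UV VU rmorph1; split=> //.
  by exists U, V; split=> //; exact: isometry_adjoint.
by exists U => //; exact: invertible_index UV VU.
Qed.

Definition u0 U : calkin_U0 H := insubd (U0_one H) (to_calkin U).

Lemma val_u0 U : unitary_op U -> U0_val (u0 U) = to_calkin U.
Proof. by move=> /unitary_op_U0 UU; rewrite /u0 -[LHS]/(val _) insubdK. Qed.

Lemma U0_valM u v : U0_val (u * v)%g = U0_val u * U0_val v. Proof. by []. Qed.
Lemma U0_valVr u : U0_val u * U0_val u^-1%g = 1.
Proof. by rewrite -U0_valM mulgV. Qed.
Lemma U0_valVl u : U0_val u^-1%g * U0_val u = 1.
Proof. by rewrite -U0_valM mulVg. Qed.

Lemma U0_dist_le0 u v : (U0_dist u v <= 0) <-> u = v.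
Proof.
split=> [/calkin_norm_le0/eqP|->]; last by rewrite /U0_dist subrr calkin_norm0.
by rewrite subr_eq0 => /eqP; exact: val_inj.
Qed.

Lemma val_u0V U V : unitary_op U -> U * V = 1 -> U0_val (u0 U)^-1%g = to_calkin V.
Proof.
move=> uU UV; rewrite -[LHS]mulr1 -(rmorph1 (@to_calkin _ H)) -UV rmorphM mulrA /=.
by rewrite -(val_u0 uU) U0_valVl mul1r.
Qed.

Lemma u0_isometric_conj U : unitary_op U -> isometric_conj (@U0_dist R H) (u0 U).
Proof.
move=> uU; have [UN [V [UV VU]]] := uU; move=> u v.
rewrite /U0_dist !U0_valM (val_u0V uU UV) (val_u0 uU) -mulrBl -mulrBr.
by apply: calkin_norm_unitary => //; exact: unitary_op_inv uU UV.
Qed.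

Lemma u0_comm S T : unitary_op S -> unitary_op T ->
  to_calkin (S * T) = to_calkin (T * S) -> (u0 S * u0 T)%g = (u0 T * u0 S)%g.
Proof.
by move=> uS uT; rewrite !rmorphM /= => E; apply: val_inj; rewrite /= !val_u0.
Qed.

End UnitaryClasses.

(** The number [3 * N + 2] is nonzero modulo 3, and a nonzero integer is smaller in absolute value
    than the power of 2 with that exponent. *)
Lemma not_divisible_by_all_powers (N : int) :
  (forall m, exists q : int, 3 * N + 2 = q * 2 ^+ m) -> False.
Proof.
move=> /(_ (absz (3 * N + 2)))[q E].
have [q0|q0] := eqVneq q 0; first by rewrite q0 mul0r in E; lia.
have := ltn_expl (absz (3 * N + 2)) (ltnSn 1).
rewrite {1}E abszM abszX ltnNge => /negP; apply; apply: leq_pmull.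
by rewrite absz_gt0.
Qed.

(** * The two sequences and the impossibility of the extension *)

Section NonHomogeneity.
Context (R : realType) (H : hilbertSpace R).
Hypotheses (Hsep : separable_space H) (Hinf : infinite_dimensional H).
Variable f : nat -> H.
Hypothesis fb : orthonormal_basis f.
Variables (code : int * nat -> nat) (decode : nat -> int * nat).
Hypotheses (codeK : cancel code decode) (decodeK : cancel decode code).

Let X := opX f code.
Let Z := opZ f code.
Let F := opF f code.
Let J := opJ f code.
Let W := opW f code.

Lemma unitary_sperm th psi psi' : cancel psi psi' -> cancel psi' psi ->
  unitary_op (sperm f code th psi).
Proof.
move=> k1 k2; have i1 := can_inj k1; have i2 := can_inj k2; split.
  by move=> x; exact: sperm_norm.
exists (sperm f code (th \o psi') psi'); rewrite !(spermM fb codeK decodeK)//.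
split; apply: (sperm1 fb codeK decodeK) => i /=; rewrite ?k1 ?k2 ?addbb//.
Qed.

Let uX : unitary_op X. Proof. exact: (@unitary_sperm _ _ id). Qed.
Let uZ n : unitary_op (Z n). Proof. exact: (@unitary_sperm _ _ id). Qed.
Let uF n : unitary_op (F n). Proof. exact: unitary_sperm (flip_idxK n) (flip_idxK n). Qed.
Let uJ : unitary_op J. Proof. exact: unitary_sperm reflect_idxK reflect_idxK. Qed.
Let uW n : unitary_op (W n). Proof. exact: unitary_sperm (shift_idxK n) (unshift_idxK n). Qed.

Let x0 := u0 X.
Let j0 := u0 J.
Let z i := u0 (Z i).
Let g i := u0 (F i).
Let w i := u0 (W i).

(** Entries [2 * i + 1] and [2 * i + 2] are the sign and the flip of digit [i]. *)
Definition seq_a n : calkin_U0 H :=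
  if n is n'.+1 then (if odd n' then g n'./2 else z n'./2) else x0.

Definition twist m : calkin_U0 H := iteri m (fun i u => (u * w i)%g) 1%g.

Definition seq_b n : calkin_U0 H := (twist n * seq_a n * (twist n)^-1)%g.

Lemma twist_isometric m : isometric_conj (@U0_dist R H) (twist m).
Proof.
elim: m => [|m IHm]; first exact: isometric_conj1.
by apply: isometric_conjM => //; exact: u0_isometric_conj.
Qed.

Lemma seq_a_comm n m : (n <= m)%N -> (w m * seq_a n)%g = (seq_a n * w m)%g.
Proof.
case: n => [|n] nm /=; first by apply: u0_comm => //; apply/esym; exact: opXW.
case: ifP => _; apply: u0_comm => //; congr to_calkin.
  by apply: opWF => //; lia.
exact: opWZ.
Qed.

(** Each further factor [w m] with [n <= m] commutes with [seq_a n] and cancels. *)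
Lemma seq_bE n m : (n <= m)%N -> seq_b n = (twist m * seq_a n * (twist m)^-1)%g.
Proof.
elim: m => [|m IHm]; first by rewrite leqn0 => /eqP ->.
rewrite leq_eqVlt => /predU1P[->//|]; rewrite ltnS => nm; rewrite IHm//= invgM.
by rewrite -[(twist m * w m * _)%g]mulgA seq_a_comm// !mulgA mulgK.
Qed.

Lemma seq_ab_type : type_of (@U0_dist R H) seq_a = type_of (@U0_dist R H) seq_b.
Proof.
apply: type_of_locally_conj => N; exists (twist N); first exact: twist_isometric.
by move=> n nN; exact/seq_bE/ltnW.
Qed.

Lemma j0_comm n : (j0 * seq_a n.+1)%g = (seq_a n.+1 * j0)%g.
Proof.
by rewrite /=; case: ifP => _; apply: u0_comm => //; congr to_calkin; [exact: opJF|exact: opJZ].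
Qed.

Lemma w_twist_comm i m : (w i * twist m)%g = (twist m * w i)%g.
Proof.
elim: m => [|m IHm]; first by rewrite mulg1 mul1g.
rewrite /= mulgA IHm -!mulgA; congr (_ * _)%g; apply: u0_comm => //.
by congr to_calkin; exact: opWWC.
Qed.

Lemma w_j0 i : (w i * j0)%g = (j0 * (w i)^-1)%g.
Proof.
apply: val_inj; rewrite /= (val_u0V (uW i) (opWW' fb codeK decodeK i)) !val_u0//.
by rewrite -!rmorphM /=; congr to_calkin; exact: opWJ.
Qed.

(** Moving [j0] to the left inverts each factor but keeps their order; commutation of the factors
    turns the result into the inverse of the product. *)
Lemma twist_j0 m : (twist m * j0)%g = (j0 * (twist m)^-1)%g.
Proof.
elim: m => [|m IHm]; first by rewrite invg1 mulg1 mul1g.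
by rewrite /= -mulgA w_j0 mulgA IHm -mulgA -invgM w_twist_comm.
Qed.

Let h := to_calkin (half_op H).
Let p := spectral h (U0_val x0).

Let hd : h + h = 1.
Proof. by rewrite -rmorphD half_op_double rmorph1. Qed.
Let hc (t : calkin H) : GRing.comm t h. Proof. exact: calkin_half_comm. Qed.

Lemma p_idem : p * p = p.
Proof.
by apply: spectral_idem => //; rewrite val_u0// -rmorphM (opXX fb codeK decodeK) rmorph1.
Qed.

Lemma p_twist m : GRing.comm p (U0_val (twist m)).
Proof.
apply/commr_sym/comm_spectral => //; rewrite /GRing.comm -!U0_valM; congr U0_val.
elim: m => [|m IHm]; first by rewrite mul1g mulg1.
by rewrite /= -mulgA (seq_a_comm (leq0n m)) mulgA IHm mulgA.
Qed.

Lemma twist_ind m : calkin_ind (corner p (U0_val (twist m))) (- \sum_(i < m) (4 ^ i)%:Z).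
Proof.
elim: m => [|m IHm].
  rewrite big_ord0 oppr0 corner1 -(rmorph1 (@to_calkin _ H)).
  by apply: (@calkin_ind_inverse _ _ 1); rewrite mulr1.
rewrite /= -cornerM; [|exact: p_idem|exact: p_twist].
rewrite big_ord_recr opprD; apply: calkin_indM => //.
rewrite val_u0// /p val_u0//.
have := corner_opW_ind fb codeK decodeK m; rewrite calkin_opP; exact.
Qed.

Lemma geometric_sum4 m : 3 * (\sum_(i < m) (4 ^ i)%:Z) = 4 ^+ m - 1 :> int.
Proof.
elim: m => [|m IHm]; first by rewrite big_ord0.
rewrite big_ord_recr mulrDr IHm exprS /= -natrX; lia.
Qed.

Let zq i : calkin H := to_calkin (Z i).
Let gq i : calkin H := to_calkin (F i).

Lemma zqK i : zq i * zq i = 1.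
Proof. by rewrite -rmorphM (opZZ fb codeK decodeK) rmorph1. Qed.
Lemma gqK i : gq i * gq i = 1.
Proof. by rewrite -rmorphM (opFF fb codeK decodeK) rmorph1. Qed.
Lemma gq_zq i : gq i * zq i = - (zq i * gq i).
Proof. by rewrite -!rmorphM /= (opFZ fb codeK decodeK) rmorphN. Qed.

Section Extension.
Variable e : calkin_U0 H.
Hypothesis eP : type_of (@U0_dist R H) (extend seq_a j0) = type_of (@U0_dist R H) (extend seq_b e).

Lemma word_transfer s t : word_eval s (extend seq_a j0) = word_eval t (extend seq_a j0) ->
  word_eval s (extend seq_b e) = word_eval t (extend seq_b e).
Proof. by move=> /U0_dist_le0/(type_of_word_eq eP)/U0_dist_le0. Qed.

Lemma e_comm n : (e * seq_b n.+1)%g = (seq_b n.+1 * e)%g.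
Proof.
(* Variable 0 is the added entry, so entry [n.+1] of the sequence is variable [n.+2]. *)
exact: (@word_transfer (WMul (WVar 0) (WVar n.+2)) (WMul (WVar n.+2) (WVar 0)) (j0_comm n)).
Qed.

(* The scalar [-1] is the word [z g z g] in the anticommuting involutions [z = seq_a 1] and
   [g = seq_a 2]. *)
Lemma e_anticomm : U0_val e * U0_val x0 = - (U0_val x0 * U0_val e).
Proof.
have nuE : U0_val (z 0 * g 0 * (z 0 * g 0))%g = -1.
  rewrite !U0_valM !val_u0// -/(zq 0) -/(gq 0) mulrA -(mulrA (zq 0) (gq 0)) gq_zq.
  by rewrite mulrN mulrA zqK mul1r mulNr gqK.
pose zg := WMul (WVar 2) (WVar 3).
have := @word_transfer (WMul (WVar 0) (WVar 1)) (WMul (WMul (WVar 1) (WVar 0)) (WMul zg zg)).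
rewrite [word_eval _ _]/= [X in (_ = X -> _) -> _]/= => E.
have {}E : (e * seq_b 0 = seq_b 0 * e * (seq_b 1 * seq_b 2 * (seq_b 1 * seq_b 2)))%g.
  apply: E; apply: val_inj; rewrite -[val _]/(U0_val _) -[RHS]/(U0_val _).
  rewrite ![U0_val (_ * _)%g]U0_valM -!U0_valM [in RHS]U0_valM nuE mulrN1 !U0_valM !val_u0//.
  by rewrite -!rmorphM /= -rmorphN; congr to_calkin; exact: opJX.
have b0 : seq_b 0 = x0 by rewrite /seq_b /= mul1g invg1 mulg1.
have b12 : (seq_b 1 * seq_b 2 = twist 2 * (z 0 * g 0) * (twist 2)^-1)%g.
  rewrite (@seq_bE 1 2)// (@seq_bE 2 2)// -[seq_a 1]/(z 0) -[seq_a 2]/(g 0).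
  by move: (twist 2) => T; rewrite !mulgA mulgVK.
(* Being central, [-1] survives conjugation by [twist 2], so the word takes the same value in
   [seq_b]. *)
have bb : U0_val (seq_b 1 * seq_b 2 * (seq_b 1 * seq_b 2))%g = -1.
  have -> : (seq_b 1 * seq_b 2 * (seq_b 1 * seq_b 2) =
      twist 2 * (z 0 * g 0 * (z 0 * g 0)) * (twist 2)^-1)%g.
    by rewrite b12; move: (twist 2) => T; rewrite !mulgA mulgVK.
  by rewrite 2!U0_valM nuE mulrN1 mulNr U0_valVr.
move: (congr1 (@U0_val R H) E); rewrite b0 U0_valM => ->.
by rewrite U0_valM bb mulrN1 U0_valM.
Qed.

Let r := U0_val j0 * U0_val e.
Let r' := U0_val e^-1%g * U0_val j0^-1%g.

Lemma rr' : r * r' = 1.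
Proof. by rewrite /r /r' mulrA -(mulrA (U0_val j0)) U0_valVr mulr1 U0_valVr. Qed.

Lemma r'r : r' * r = 1.
Proof. by rewrite /r /r' mulrA -(mulrA (U0_val e^-1%g)) U0_valVl mulr1 U0_valVl. Qed.

(** Both factors of [r] anticommute with the class of [X], so their product commutes with it. *)
Lemma p_r : GRing.comm p r.
Proof.
apply/commr_sym/comm_spectral/commr_sym => //.
have jx : U0_val j0 * U0_val x0 = - (U0_val x0 * U0_val j0).
  by rewrite !val_u0// -!rmorphM /= -rmorphN; congr to_calkin; exact: opJX.
by rewrite /GRing.comm /r -mulrA e_anticomm mulrN !mulrA jx mulNr opprK.
Qed.

Lemma index_divisible N : calkin_ind (corner p r) N ->
  forall m, exists q : int, 3 * N + 2 = q * 2 ^+ m.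
Proof.
(* The pairs with [i < m] occupy the entries of [seq_a] from 1 to [2 * m], for which conjugation by
   [twist M] already gives [seq_b]. *)
move=> indN m; pose M := (2 * m)%N.
pose U := U0_val (twist M); pose U' := U0_val (twist M)^-1%g.
have UU' : U * U' = 1 by exact: U0_valVr.
have U'U : U' * U = 1 by exact: U0_valVl.
have pr := p_r.
have pU : GRing.comm p U by exact: p_twist.
have pU' : GRing.comm p U' by exact: comm_inverse U'U UU' pU.
have pr' : GRing.comm p r' by exact: comm_inverse r'r rr' p_r.
have tE : corner p (U * r * U) = corner p U * corner p r * corner p U.
  rewrite cornerM//; last exact: p_idem.
  by rewrite cornerM//; [exact: p_idem|exact: commrM].
have indt := calkin_indM (calkin_indM (twist_ind M) indN) (twist_ind M).
rewrite -/U -/r -tE in indt.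
have st : corner p (U' * r' * U') * corner p (U * r * U) = 1.
  rewrite cornerM; [|exact: p_idem|by apply: commrM => //; exact: commrM].
  by rewrite (mul_sandwich U'U r'r) corner1.
have ts : corner p (U * r * U) * corner p (U' * r' * U') = 1.
  rewrite cornerM; [|exact: p_idem|by apply: commrM => //; exact: commrM].
  by rewrite (mul_sandwich UU' rr') corner1.
have conjE : (twist M * j0 * e * twist M = j0 * ((twist M)^-1 * e * twist M))%g.
  by rewrite twist_j0 !mulgA.
have comm_a n : (n < M)%N -> GRing.comm (U0_val (seq_a n.+1)) (corner p (U * r * U)).
  move=> nM; apply: comm_corner.
    apply: comm_spectral => //; rewrite /GRing.comm.
    rewrite /=; case: ifP => _; rewrite !val_u0// -!rmorphM /=; congr to_calkin; apply/esym.
      exact: opXF.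
    exact: opXZ.
  (* Since [j0] commutes with [seq_a n.+1], it remains to commute the conjugate of [e], which is
     [e_comm] conjugated back by [twist M]. *)
  rewrite /U /r mulrA -!U0_valM conjE /GRing.comm -!U0_valM; congr U0_val.
  have := e_comm n; rewrite (@seq_bE n.+1 M)// => E.
  rewrite mulgA -j0_comm -!mulgA; congr (_ * _)%g; apply: (mulgI (twist M)).
  by move: E; rewrite !mulgA mulgV mul1g => E; apply: (mulIg (twist M)^-1%g); rewrite mulgK E.
have comm_g i : (i < m)%N -> GRing.comm (gq i) (corner p (U * r * U)).
  move=> im; have := @comm_a (2 * i).+1; rewrite /M /= mul2n odd_double /= uphalf_double val_u0//.
  by apply; lia.
have comm_z i : (i < m)%N -> GRing.comm (zq i) (corner p (U * r * U)).
  move=> im; have := @comm_a (2 * i)%N; rewrite /M /= mul2n odd_double /= doubleK val_u0//.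
  by apply; lia.
have [q E] : exists q : int,
    - (\sum_(i < M) (4 ^ i)%:Z) + N - (\sum_(i < M) (4 ^ i)%:Z) = q * 2 ^+ m.
  apply: (ind_divisible (ind := @calkin_ind R H) (calkin_ind_exists Hsep Hinf)
    (calkin_ind_uniq Hsep Hinf)
    (@calkin_indM R H) hd hc (x := gq) (z := zq) _ _ _ st ts indt).
  - move=> i _; split; [exact: gqK|exact: zqK|exact: gq_zq|].
    by apply: (@calkin_ind_inverse _ _ (F i)); rewrite (opFF fb codeK decodeK).
  - move=> i k _ _ ik; rewrite /GRing.comm -!rmorphM /=; split; congr to_calkin.
      exact: opFZC.
    exact: opZZC.
  - by move=> i im; split; [exact: comm_g|exact: comm_z].
have K3 := geometric_sum4 M; set K := \sum_(i < M) _ in E K3.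
have M4 : (4 : int) ^+ M = 2 ^+ (3 * m) * 2 ^+ m.
  by rewrite (_ : (4 : int) = 2 ^+ 2)// -exprM -exprD /M; congr (_ ^+ _); lia.
(* From [N - 2 * K = q * 2 ^+ m] and [3 * K = 4 ^+ M - 1] follows
   [3 * N + 2 = 3 * q * 2 ^+ m + 2 * 4 ^+ M], where [4 ^+ M] is itself a multiple of [2 ^+ m]. *)
exists (3 * q + 2 * 2 ^+ (3 * m)); rewrite [RHS]mulrDl -!mulrA -E -M4.
have -> : (4 : int) ^+ M = 3 * K + 1 by rewrite K3 subrK.
by ring.
Qed.

Lemma extension_absurd : False.
Proof.
have pr' : GRing.comm p r' by exact: comm_inverse r'r rr' p_r.
have [||N /index_divisible] := @calkin_ind_exists R H Hsep Hinf (corner p r') (corner p r).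
- by rewrite cornerM ?r'r ?corner1//; exact: p_idem.
- by rewrite cornerM ?rr' ?corner1//; [exact: p_idem|exact: p_r].
exact: not_divisible_by_all_powers.
Qed.

End Extension.

Lemma not_countably_homogeneous : ~ countably_homogeneous (@U0_dist R H).
Proof.
by move=> /(_ _ _ seq_ab_type j0)[e /extension_absurd].
Qed.

End NonHomogeneity.

Lemma int_nat_bijection : exists (code : int * nat -> nat) (decode : nat -> int * nat),
  cancel code decode /\ cancel decode code.
Proof.
have : ([set: int * nat] #= [set: nat])%card.
  apply: eq_card_nat; first exact: countableP.
  move=> /(finite_image snd); have -> : snd @` [set: int * nat] = [set: nat].
    by apply/seteqP; split=> // n _; exists (0, n).
  exact: infinite_nat.
move=> /card_set_bijP[code]; rewrite setTT_bijective => -[decode k1 k2].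
by exists code, decode.
Qed.

Theorem theorem2 (R : realType) (H : hilbertSpace R)
  (Hsep : separable_space H) (Hinf : infinite_dimensional H) :
  ~ countably_homogeneous (G := calkin_U0 H) (@U0_dist R H).
Proof.
have [f fb] := orthonormal_basis_exists Hsep Hinf.
have [code [decode [codeK decodeK]]] := int_nat_bijection.
exact (not_countably_homogeneous Hsep Hinf fb codeK decodeK).
Qed.
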